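(* Let $F(\tau)=\eta^6(\tau)\Big/\Big(\theta\begin{bmatrix}1/5\\1/5\end{bmatrix}(0,\tau)\,\theta\begin{bmatrix}1/5\\9/5\end{bmatrix}(0,\tau)\Big)$. For every $M=\begin{pmatrix} a&b\\ c&d\end{pmatrix}\in\Gamma_{\theta,5}$, $F(M\tau)=\nu_F(M)(c\tau+d)^2F(\tau)$ with $\nu_F(M)=\exp\!\left(\frac{\pi i}{5}f(M)\right)$, where $f(M)=\frac{4b}{5}+\frac{8ab}{5}+\frac{8cd}{5}$ if $M\equiv I\pmod5$; $f(M)=\frac{6b}{5}+\frac{8ab}{5}+\frac{8cd}{5}$ if $M\equiv -I\pmod5$; $f(M)=5+\frac{4d}{5}+\frac{8ab}{5}+\frac{8cd}{5}$ if $M\equiv\begin{pmatrix}0&-1\\1&0\end{pmatrix}\pmod5$; $f(M)=5-\frac{4d}{5}+\frac{8ab}{5}+\frac{8cd}{5}$ if $M\equiv\begin{pmatrix}0&1\\-1&0\end{pmatrix}\pmod5$.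
   Context: $\mathscr{H}$ is the upper half plane, $M\tau=\frac{a\tau+b}{c\tau+d}$, $I$ the identity matrix. $\theta\begin{bmatrix}\epsilon\\ \epsilon'\end{bmatrix}(v,\tau)=\sum_{n\in\mathbb{Z}}\exp\!\Big(2\pi i\Big[\tfrac12\big(n+\tfrac{\epsilon}{2}\big)^2\tau+\big(n+\tfrac{\epsilon}{2}\big)\big(v+\tfrac{\epsilon'}{2}\big)\Big]\Big)$. $\eta(\tau)=q^{1/24}\prod_{n\ge1}(1-q^n)$, $q=e^{2\pi i\tau}$. $\Gamma_{\theta,5}=\{M\in SL(2,\mathbb{Z}): M\equiv\pm\begin{pmatrix}1&0\\0&1\end{pmatrix}\text{ or }\pm\begin{pmatrix}0&-1\\1&0\end{pmatrix}\pmod 5\}$. *)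

(* Defs.v *)
From Stdlib Require Import Reals ZArith.
From Coquelicot Require Import Coquelicot.
Open Scope R_scope.

Definition cexp (z : C) : C :=
  (exp (Re z) * cos (Im z), exp (Re z) * sin (Im z)).

Definition Ci : C := (0, 1).

Definition CSeries (a : nat -> C) : C :=
  @iota C_CompleteNormedModule (fun l : C => is_series a l).

Fixpoint partial_prod (u : nat -> C) (N : nat) : C :=
  match N with
  | O => 1%C
  | S k => Cmult (partial_prod u k) (u (S k))
  end.
Definition CProd1 (u : nat -> C) : C :=
  @iota C_CompleteNormedModule (fun l : C => filterlim (partial_prod u) eventually (locally l)).

Definition q_of (tau : C) : C := cexp (Cmult (RtoC (2 * PI)) (Cmult Ci tau)).
Definition eta (tau : C) : C :=
  Cmult (cexp (Cmult (RtoC (2 * PI / 24)) (Cmult Ci tau)))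
        (CProd1 (fun n => Cminus 1 (pow_n (q_of tau) n))).

Definition theta_term (eps eps' : R) (v tau : C) (n : Z) : C :=
  let m := IZR n + eps / 2 in
  cexp (Cmult (Cmult (RtoC (2 * PI)) Ci)
         (Cplus (Cmult (RtoC (m * m / 2)) tau)
                (Cmult (RtoC m) (Cplus v (RtoC (eps' / 2)))))).

Definition theta (eps eps' : R) (v tau : C) : C :=
  Cplus (CSeries (fun k => theta_term eps eps' v tau (Z.of_nat k)))
        (CSeries (fun k => theta_term eps eps' v tau (- Z.of_nat (S k))%Z)).

Definition F (tau : C) : C :=
  Cdiv (pow_n (eta tau) 6)
       (Cmult (theta (1/5) (1/5) 0 tau) (theta (1/5) (9/5) 0 tau)).

Definition moeb (a b c d : Z) (tau : C) : C :=
  Cdiv (Cplus (Cmult (IZR a) tau) (IZR b)) (Cplus (Cmult (IZR c) tau) (IZR d)).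

Definition cong5 (a b c d a0 b0 c0 d0 : Z) : Prop :=
  (a mod 5 = a0 mod 5 /\ b mod 5 = b0 mod 5 /\
   c mod 5 = c0 mod 5 /\ d mod 5 = d0 mod 5)%Z.
Definition cong5b (a b c d a0 b0 c0 d0 : Z) : bool :=
  andb (andb (Z.eqb (Z.modulo a 5) (Z.modulo a0 5)) (Z.eqb (Z.modulo b 5) (Z.modulo b0 5)))
       (andb (Z.eqb (Z.modulo c 5) (Z.modulo c0 5)) (Z.eqb (Z.modulo d 5) (Z.modulo d0 5))).

Definition in_Gamma_theta5 (a b c d : Z) : Prop :=
  (a * d - b * c = 1)%Z /\
  (cong5 a b c d 1 0 0 1 \/ cong5 a b c d (-1) 0 0 (-1) \/
   cong5 a b c d 0 (-1) 1 0 \/ cong5 a b c d 0 1 (-1) 0).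

Definition fM (a b c d : Z) : R :=
  let common := 8 * IZR a * IZR b / 5 + 8 * IZR c * IZR d / 5 in
  if cong5b a b c d 1 0 0 1 then 4 * IZR b / 5 + common
  else if cong5b a b c d (-1) 0 0 (-1) then 6 * IZR b / 5 + common
  else if cong5b a b c d 0 (-1) 1 0 then 5 + 4 * IZR d / 5 + common
  else 5 - 4 * IZR d / 5 + common.

Definition nuF (a b c d : Z) : C :=
  cexp (Cmult Ci (RtoC (PI * fM a b c d / 5))).

(* Main.v *)
Require Import Defs.
From Stdlib Require Import Reals ZArith.
From Coquelicot Require Import Coquelicot.
From Stdlib Require Import Lra Lia Psatz FunctionalExtensionality Classical_Prop.
Open Scope R_scope.

(** Put [E(v, tau) = theta[1,1](v, tau)], an odd entire function of [v] with quasi-periods [1] and [tau]. Jacobi's identity gives [E'(0, tau) = -2 pi eta^3], and both theta constants in [F] are values of [E] at 5-torsion points, so that up to a constant [F = E'(0)^2 / (k_u k_w)] for two Klein forms [k_u], [k_w].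
    For [M] in SL(2,Z) and [j = c tau + d], the function [exp (- pi i c v^2 / j) E(v / j, M tau)] has the same quasi-periods as [E(v, tau)]. Such functions are unique up to a factor, hence it is [K E(v, tau)]; the derivative at [0] gives [eta^3(M tau) = j K eta^3(tau)], and the unknown [K] cancels in [F]. What is left is the action of [M] on the characteristics modulo lattice translations.
    Uniqueness: the Fourier coefficients on a horizontal line do not depend on its height, quasi-periodicity links consecutive ones, and a smooth periodic function without Fourier coefficients vanishes. *)

(** * The complex exponential *)

(** The powers match: [eta^6] is the square of [eta^3] and acquires [(j K)^2], while each of the two
    Klein forms acquires one [K], so that only [j^2] survives. Neither the root of unity nor the
    branch of the square root of [j] inside [K] has to be determined. A theta constant with
    characteristic [(1 + 2 r, 1 + 2 s)] corresponds to the point [r tau + s]. The two constants of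
    [F] give [(r, s) = (-2/5, -2/5)] and [(-2/5, 2/5)]. Right multiplication by [I] or [- I] modulo
    5 keeps each of them up to sign and integer vectors; the other two classes of the group exchange
    them. The phases of these translations and the signs make up [nuF]. Holomorphy enters only
    through explicit remainder bounds. In place of Cauchy's theorem, a line of integration is moved
    because a function with quadratic increments is constant. Jacobi's identity is a limit of finite
    identities between q-binomials. It also gives [eta <> 0], which keeps [theta 1 1] from being
    identically zero, as uniqueness up to a factor requires. *)

Lemma Cmod_le_Rabs_Re_Im (z : C) : Cmod z <= Rabs (Re z) + Rabs (Im z).
Proof.
  pose proof (Rabs_pos (Re z)); pose proof (Rabs_pos (Im z)).
  unfold Cmod. rewrite <- (sqrt_Rsqr (Rabs (Re z) + Rabs (Im z))) by lra.
  apply sqrt_le_1_alt. unfold Rsqr.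
  change (fst z) with (Re z); change (snd z) with (Im z).
  rewrite <- (pow2_abs (Re z)), <- (pow2_abs (Im z)). nra.
Qed.

Lemma Im_le_Cmod (z : C) : Rabs (Im z) <= Cmod z.
Proof. exact (Rle_trans _ _ _ (Rmax_r _ _) (Rmax_Cmod z)). Qed.

Lemma cexp_plus (z w : C) : cexp (z + w) = (cexp z * cexp w)%C.
Proof.
  destruct z as [x y], w as [x' y']. unfold cexp, Cmult; simpl.
  rewrite exp_plus, cos_plus, sin_plus. f_equal; ring.
Qed.

Lemma cexp_0 : cexp 0 = 1%C.
Proof. unfold cexp; simpl. rewrite exp_0, cos_0, sin_0. unfold RtoC; f_equal; ring. Qed.

Lemma cexp_inv_l (z : C) : (cexp (- z) * cexp z)%C = 1%C.
Proof. rewrite <- cexp_plus, <- cexp_0. f_equal. ring. Qed.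

Lemma Cmod_cexp (z : C) : Cmod (cexp z) = exp (Re z).
Proof.
  unfold Cmod, cexp; simpl.
  replace (_ + _) with (Rsqr (exp (Re z)) * ((Rsqr (sin (Im z))) + Rsqr (cos (Im z))))
    by (unfold Rsqr; ring).
  rewrite sin2_cos2, Rmult_1_r, sqrt_Rsqr; auto. left; apply exp_pos.
Qed.

Lemma cexp_neq_0 (z : C) : cexp z <> 0%C.
Proof. apply Cmod_gt_0. rewrite Cmod_cexp. apply exp_pos. Qed.

Lemma cexp_opp (z : C) : cexp (- z) = (/ cexp z)%C.
Proof.
  pose proof (cexp_neq_0 z).
  replace (cexp (- z)) with (cexp (- z) * cexp z * / cexp z)%C by (field; auto).
  rewrite cexp_inv_l. ring.
Qed.

Lemma cexp_period (k : Z) : cexp (2 * PI * IZR k * Ci)%C = 1%C.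
Proof.
  assert (H : forall n : nat, cexp (2 * PI * INR n * Ci)%C = 1%C).
  { induction n as [|n IH].
    - simpl. rewrite <- cexp_0. f_equal. ring.
    - rewrite S_INR, RtoC_plus.
      replace (2 * PI * (INR n + 1) * Ci)%C with (2 * PI * INR n * Ci + 2 * PI * Ci)%C by ring.
      rewrite cexp_plus, IH. unfold cexp; simpl.
      replace ((2 * PI - 0 * 0) * 0 - (2 * 0 + 0 * PI) * 1) with 0 by ring.
      replace ((2 * PI - 0 * 0) * 1 + (2 * 0 + 0 * PI) * 0) with (2 * PI) by ring.
      rewrite exp_0, cos_2PI, sin_2PI. unfold Cmult, RtoC; simpl; f_equal; ring. }
  destruct (Z_le_gt_dec 0 k) as [Hk|Hk].
  - rewrite <- (Z2Nat.id k) by lia. rewrite <- INR_IZR_INZ. apply H.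
  - replace k with (- Z.of_nat (Z.to_nat (- k)))%Z by lia.
    rewrite opp_IZR, <- INR_IZR_INZ, RtoC_opp.
    replace (2 * PI * - INR (Z.to_nat (- k)) * Ci)%C
      with (- (2 * PI * INR (Z.to_nat (- k)) * Ci))%C by ring.
    rewrite cexp_opp, H. field.
Qed.

Lemma cexp_eq_mod (z w : C) (k : Z) :
  (z = w + 2 * PI * IZR k * Ci)%C -> cexp z = cexp w.
Proof. intros ->. rewrite cexp_plus, cexp_period. ring. Qed.

Lemma cexp_PI : cexp (PI * Ci) = (- (1))%C.
Proof.
  unfold cexp; simpl. replace (PI * 0 - 0 * 1) with 0 by ring. replace (PI * 1 + 0 * 0) with PI by ring.
  rewrite exp_0, cos_PI, sin_PI. unfold RtoC, Copp; simpl; f_equal; ring.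
Qed.

Lemma exp_le (x y : R) : x <= y -> exp x <= exp y.
Proof. intros [H|<-]; [left; apply exp_increasing; auto|lra]. Qed.

Lemma exp_minus_1_bound (x : R) : Rabs (exp x - 1) <= Rabs x * exp (Rabs x).
Proof.
  pose proof (exp_ineq1_le x). pose proof (exp_ineq1_le (- x)).
  assert (exp x * exp (- x) = 1) by (rewrite <- exp_plus, Rplus_opp_r; apply exp_0).
  pose proof (exp_pos x). pose proof (exp_pos (- x)).
  destruct (Rle_dec 0 x) as [Hx|Hx].
  - rewrite !(Rabs_right x) by lra. rewrite Rabs_right by lra. nra.
  - rewrite !(Rabs_left x) by lra.
    rewrite Rabs_left1 by nra. nra.
Qed.

Lemma exp_taylor_bound (x : R) : Rabs (exp x - 1 - x) <= x * x * exp (Rabs x).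
Proof.
  pose proof (exp_ineq1_le x). pose proof (exp_ineq1_le (- x)).
  assert (exp x * exp (- x) = 1) by (rewrite <- exp_plus, Rplus_opp_r; apply exp_0).
  pose proof (exp_pos x). pose proof (exp_pos (- x)).
  pose proof (exp_minus_1_bound x) as Hb.
  rewrite Rabs_right by lra.
  (* This is [1 - x <= exp (- x)] multiplied by [exp x], valid for both signs of [x]. *)
  apply Rle_trans with (x * (exp x - 1)); [nra|].
  apply Rle_trans with (Rabs x * Rabs (exp x - 1)).
  - rewrite <- Rabs_mult. apply Rle_abs.
  - replace (x * x) with (Rabs x * Rabs x) by (rewrite <- Rabs_mult; apply Rabs_right; nra).
    rewrite Rmult_assoc. apply Rmult_le_compat_l; auto. apply Rabs_pos.
Qed.

Lemma Rabs_sin_le (x : R) : Rabs (sin x) <= Rabs x.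
Proof.
  assert (H : forall y, 0 <= y -> Rabs (sin y) <= y).
  { intros y Hy. destruct (Rle_dec y 1) as [H1|H1].
    - pose proof PI2_3_2. destruct Hy as [Hy|<-].
      + pose proof (sin_lt_x y Hy). pose proof (sin_ge_0 y ltac:(lra) ltac:(lra)).
        rewrite Rabs_right; lra.
      + rewrite sin_0, Rabs_R0. lra.
    - pose proof (SIN_bound y). apply Rabs_le. lra. }
  destruct (Rle_dec 0 x) as [Hx|Hx].
  - rewrite (Rabs_right x) by lra. auto.
  - rewrite (Rabs_left x) by lra. rewrite <- (Ropp_involutive x) at 1.
    rewrite sin_neg, Rabs_Ropp. apply H. lra.
Qed.

Lemma cos_minus_1 (y : R) : cos y - 1 = - 2 * (sin (y / 2) * sin (y / 2)).
Proof.
  replace (cos y) with (cos (2 * (y / 2))) by (f_equal; field).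
  rewrite cos_2a_sin. ring.
Qed.

Lemma cos_taylor_bound (y : R) : Rabs (cos y - 1) <= y * y.
Proof.
  rewrite cos_minus_1. pose proof (Rabs_sin_le (y / 2)) as H.
  pose proof (Rabs_pos (sin (y / 2))).
  rewrite Rabs_mult, Rabs_mult, (Rabs_left (-2)) by lra.
  assert (Rabs (y / 2) * Rabs (y / 2) = y * y / 4).
  { rewrite <- Rabs_mult, Rabs_right by nra. field. }
  nra.
Qed.

(** The mean value theorem with [|cos c - 1| <= |c|]. The true order is cubic, but the remainder of
    [cexp] only asks for a quadratic one. *)
Lemma sin_taylor_bound (y : R) : Rabs (sin y - y) <= y * y.
Proof.
  destruct (MVT_gen (fun t => sin t - t) 0 y (fun t => cos t - 1)) as [c [Hc Heq]].
  - intros x _. auto_derive; auto. ring.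
  - intros x _. apply continuity_pt_minus; [apply continuity_sin|apply derivable_continuous_pt, derivable_pt_id].
  - rewrite sin_0 in Heq. replace (sin y - y) with ((cos c - 1) * y) by lra.
    rewrite Rabs_mult.
    assert (Rabs (cos c - 1) <= Rabs c).
    { rewrite cos_minus_1, Rabs_mult, Rabs_mult, (Rabs_left (-2)) by lra.
      pose proof (Rabs_sin_le (c / 2)) as H. pose proof (Rabs_pos (sin (c / 2))).
      assert (Rabs (sin (c / 2)) <= 1) by (apply Rabs_le; pose proof (SIN_bound (c/2)); lra).
      assert (Rabs (c / 2) = Rabs c / 2) by (unfold Rdiv; rewrite Rabs_mult, (Rabs_right (/2)) by lra; auto).
      nra. }
    assert (Rabs c <= Rabs y).
    { destruct (Rle_dec 0 y).
      - rewrite Rmin_left, Rmax_right in Hc by lra. rewrite !Rabs_right; lra.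
      - rewrite Rmin_right, Rmax_left in Hc by lra. rewrite !Rabs_left1; lra. }
    replace (y * y) with (Rabs y * Rabs y) by (rewrite <- Rabs_mult; apply Rabs_right; nra).
    pose proof (Rabs_pos y). nra.
Qed.

Lemma cexp_taylor_bound (z : C) :
  Cmod (cexp z - 1 - z) <= 3 * exp (Rabs (Re z)) * (Cmod z * Cmod z).
Proof.
  destruct z as [x y].
  assert (Hm : Cmod (x, y) * Cmod (x, y) = x * x + y * y).
  { transitivity (Cmod (x,y) ^ 2); [ring|]. rewrite Cmod2_alt. simpl. ring. }
  rewrite Hm.
  eapply Rle_trans; [apply Cmod_le_Rabs_Re_Im|]. unfold cexp; simpl.
  pose proof (exp_taylor_bound x) as H1. pose proof (exp_minus_1_bound x) as H2.
  pose proof (cos_taylor_bound y) as H3. pose proof (sin_taylor_bound y) as H4.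
  pose proof (exp_le _ _ (Rle_abs x)) as Hle.
  pose proof (exp_pos x). pose proof (exp_pos (Rabs x)).
  set (M := exp (Rabs x)) in *. set (e := exp x) in *.
  replace (e * cos y + - (1) + - x) with (e * (cos y - 1) + (e - 1 - x)) by ring.
  replace (e * sin y + - 0 + - y) with (e * (sin y - y) + (e - 1) * y) by ring.
  assert (Rabs (e * (cos y - 1) + (e - 1 - x)) <= M * (y * y) + x * x * M).
  { eapply Rle_trans; [apply Rabs_triang|]. apply Rplus_le_compat; auto.
    rewrite Rabs_mult, (Rabs_right e) by lra. apply Rmult_le_compat; try lra. apply Rabs_pos. }
  assert (Rabs (e * (sin y - y) + (e - 1) * y) <= M * (y * y) + Rabs x * M * Rabs y).
  { eapply Rle_trans; [apply Rabs_triang|]. rewrite !Rabs_mult, (Rabs_right e) by lra.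
    apply Rplus_le_compat.
    - apply Rmult_le_compat; try lra. apply Rabs_pos.
    - apply Rmult_le_compat_r; auto. apply Rabs_pos. }
  (* The mixed term comes from [(e - 1) * y]. After AM-GM both components add up to at most
     [M (3/2 x^2 + 5/2 y^2)], whence the constant 3. *)
  assert (Rabs x * Rabs y <= (x * x + y * y) / 2).
  { pose proof (Rle_0_sqr (Rabs x - Rabs y)) as h. unfold Rsqr in h.
    replace (x * x) with (Rabs x * Rabs x) by (rewrite <- Rabs_mult; apply Rabs_right; nra).
    replace (y * y) with (Rabs y * Rabs y) by (rewrite <- Rabs_mult; apply Rabs_right; nra).
    lra. }
  nra.
Qed.

(** * Holomorphy through quadratic Taylor bounds *)

(* Locally uniform quadratic Taylor bounds: a form of holomorphy with derivative [f'] that passes to termwise differentiated series without any theory of uniform convergence. *)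
Definition hol (f f' : C -> C) : Prop :=
  forall R : R, exists K : Rdefinitions.R, 0 <= K /\
    forall v h : C, Cmod v <= R -> Cmod h <= R ->
      Cmod (f v) <= K /\ Cmod (f' v) <= K /\
      Cmod (f (v + h) - f v - h * f' v)%C <= K * (Cmod h * Cmod h).

Lemma hol_ext (f g f' g' : C -> C) :
  (forall v, f v = g v) -> (forall v, f' v = g' v) -> hol f f' -> hol g g'.
Proof.
  intros H H' Hf. replace g with f by (apply functional_extensionality; auto).
  replace g' with f' by (apply functional_extensionality; auto). auto.
Qed.

Lemma Cmod_sum_le (x y : C) (a b : R) : Cmod x <= a -> Cmod y <= b -> Cmod (x + y) <= a + b.
Proof. intros. eapply Rle_trans; [apply Cmod_triangle|]. lra. Qed.

Lemma Cmod_prod_le (x y : C) (a b : R) : Cmod x <= a -> Cmod y <= b -> Cmod (x * y) <= a * b.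
Proof. intros. rewrite Cmod_mult. apply Rmult_le_compat; auto using Cmod_ge_0. Qed.

Lemma hol_const (c : C) : hol (fun _ => c) (fun _ => 0%C).
Proof.
  intros R. exists (Cmod c). split; [apply Cmod_ge_0|]. intros v h Hv Hh.
  replace (c - c - h * 0)%C with (RtoC 0) by ring. rewrite Cmod_0.
  pose proof (Cmod_ge_0 c). pose proof (Cmod_ge_0 h). repeat split; try lra.
  repeat apply Rmult_le_pos; auto.
Qed.

Lemma hol_id : hol (fun v => v) (fun _ => 1%C).
Proof.
  intros R. exists (Rabs R + 1). pose proof (Rabs_pos R). pose proof (Rle_abs R).
  split; [lra|]. intros v h Hv Hh.
  replace (v + h - v - h * 1)%C with (RtoC 0) by ring. rewrite Cmod_0, Cmod_1.
  pose proof (Cmod_ge_0 h). repeat split; try lra.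
  repeat apply Rmult_le_pos; auto; lra.
Qed.

Lemma hol_plus (f g f' g' : C -> C) : hol f f' -> hol g g' ->
  hol (fun v => f v + g v)%C (fun v => f' v + g' v)%C.
Proof.
  intros Hf Hg R. destruct (Hf R) as [K [HK Hf']]. destruct (Hg R) as [L [HL Hg']].
  exists (K + L). split; [lra|]. intros v h Hv Hh.
  destruct (Hf' v h Hv Hh) as [a [b c]]. destruct (Hg' v h Hv Hh) as [a' [b' c']].
  repeat split; try (apply Cmod_sum_le; auto).
  replace (f (v + h) + g (v + h) - (f v + g v) - h * (f' v + g' v))%C
    with ((f (v + h) - f v - h * f' v) + (g (v + h) - g v - h * g' v))%C by ring.
  rewrite Rmult_plus_distr_r. apply Cmod_sum_le; auto.
Qed.

Lemma hol_increment (f f' : C -> C) : hol f f' -> forall R, exists K, 0 <= K /\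
  forall v h, Cmod v <= R -> Cmod h <= R -> Cmod (f (v + h) - f v)%C <= K * Cmod h.
Proof.
  intros Hf R. destruct (Hf R) as [K [HK H]]. pose proof (Rabs_pos R) as HR.
  exists (K * Rabs R + K). split; [nra|]. intros v h Hv Hh.
  destruct (H v h Hv Hh) as [_ [b c]].
  replace (f (v + h) - f v)%C with ((f (v + h) - f v - h * f' v) + h * f' v)%C by ring.
  pose proof (Cmod_ge_0 h). pose proof (Rle_abs R).
  replace ((K * Rabs R + K) * Cmod h) with (K * (Rabs R * Cmod h) + Cmod h * K) by ring.
  apply Cmod_sum_le.
  - eapply Rle_trans; [exact c|]. apply Rmult_le_compat_l; auto.
    apply Rmult_le_compat_r; lra.
  - apply Cmod_prod_le; lra.
Qed.

(** The remainder of a product consists of the two single remainders and the product of the two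
    increments, which is quadratic because each increment is Lipschitz. *)
Lemma hol_mult (f g f' g' : C -> C) : hol f f' -> hol g g' ->
  hol (fun v => f v * g v)%C (fun v => f' v * g v + f v * g' v)%C.
Proof.
  intros Hf Hg R.
  destruct (hol_increment _ _ Hf R) as [K' [HK' If]].
  destruct (hol_increment _ _ Hg R) as [L' [HL' Ig]].
  destruct (Hf R) as [K [HK Hf']]. destruct (Hg R) as [L [HL Hg']].
  exists (2 * (K * L) + K' * L'). split; [nra|]. intros v h Hv Hh.
  specialize (If v h Hv Hh). specialize (Ig v h Hv Hh).
  destruct (Hf' v h Hv Hh) as [a [b c]]. destruct (Hg' v h Hv Hh) as [a' [b' c']].
  pose proof (Rmult_le_pos _ _ HK HL). pose proof (Rmult_le_pos _ _ HK' HL').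
  pose proof (Cmod_ge_0 h).
  repeat split.
  - apply Rle_trans with (K * L); [apply Cmod_prod_le; auto|lra].
  - apply Rle_trans with (K * L + K * L); [|lra].
    apply Cmod_sum_le; apply Cmod_prod_le; auto.
  - replace (f (v + h) * g (v + h) - f v * g v - h * (f' v * g v + f v * g' v))%C
      with (((f (v + h) - f v - h * f' v) * g v + f v * (g (v + h) - g v - h * g' v))
             + (f (v + h) - f v) * (g (v + h) - g v))%C by ring.
    replace ((2 * (K * L) + K' * L') * (Cmod h * Cmod h))
      with ((K * (Cmod h * Cmod h)) * L + K * (L * (Cmod h * Cmod h))
            + (K' * Cmod h) * (L' * Cmod h)) by ring.
    repeat apply Cmod_sum_le; apply Cmod_prod_le; auto.
Qed.

Lemma hol_scal (c : C) (f f' : C -> C) : hol f f' ->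
  hol (fun v => c * f v)%C (fun v => c * f' v)%C.
Proof.
  intros Hf. eapply hol_ext; [| |exact (hol_mult _ _ _ _ (hol_const c) Hf)]; intros; simpl; ring.
Qed.

Lemma hol_minus (f g f' g' : C -> C) : hol f f' -> hol g g' ->
  hol (fun v => f v - g v)%C (fun v => f' v - g' v)%C.
Proof.
  intros Hf Hg.
  eapply hol_ext; [| |exact (hol_plus _ _ _ _ Hf (hol_scal (- (1))%C _ _ Hg))];
    intros; simpl; ring.
Qed.

Lemma hol_comp (f g f' g' : C -> C) : hol f f' -> hol g g' ->
  hol (fun v => g (f v)) (fun v => f' v * g' (f v))%C.
Proof.
  intros Hf Hg R.
  destruct (hol_increment _ _ Hf R) as [K' [HK' If]].
  destruct (Hf R) as [K [HK Hf']].
  (* The disk for [g] has to hold both the point [f v], of size at most [K], and the increment of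
     [f], of size at most [K' * Rabs R]. *)
  destruct (Hg (K + K' * Rabs R)) as [L [HL Hg']].
  exists (L + K * L + L * (K' * K') + K * L). split; [nra|]. intros v h Hv Hh.
  specialize (If v h Hv Hh).
  destruct (Hf' v h Hv Hh) as [a [b c]].
  pose proof (Cmod_ge_0 h) as H0. pose proof (Rle_abs R). pose proof (Rabs_pos R).
  assert (K' * Cmod h <= K' * Rabs R) by (apply Rmult_le_compat_l; lra).
  assert (0 <= K' * Rabs R) by nra.
  destruct (Hg' (f v) (f (v + h) - f v)%C ltac:(lra) ltac:(lra)) as [a' [b' c']].
  replace (f v + (f (v + h) - f v))%C with (f (v + h))%C in c' by ring.
  repeat split.
  - pose proof (Rmult_le_pos _ _ HK HL). pose proof (Rmult_le_pos _ _ HK' HK'). nra.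
  - apply Rle_trans with (K * L); [apply Cmod_prod_le; auto|].
    pose proof (Rmult_le_pos _ _ HK HL). pose proof (Rmult_le_pos _ _ HK' HK'). nra.
  - replace (g (f (v + h)) - g (f v) - h * (f' v * g' (f v)))%C
      with ((g (f (v + h)) - g (f v) - (f (v + h) - f v) * g' (f v))
            + (f (v + h) - f v - h * f' v) * g' (f v))%C by ring.
    apply Rle_trans with (L * (K' * K') * (Cmod h * Cmod h) + (K * (Cmod h * Cmod h)) * L).
    + apply Cmod_sum_le.
      * eapply Rle_trans; [exact c'|].
        rewrite Rmult_assoc. apply Rmult_le_compat_l; auto.
        apply Rle_trans with ((K' * Cmod h) * (K' * Cmod h)); [|right; ring].
        apply Rmult_le_compat; auto using Cmod_ge_0.
      * apply Cmod_prod_le; auto.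
    + pose proof (Rmult_le_pos _ _ HK HL). pose proof (Rmult_le_pos _ _ H0 H0).
      assert (0 <= (L + K * L) * (Cmod h * Cmod h)) by (apply Rmult_le_pos; lra). lra.
Qed.

Lemma hol_cexp : hol cexp cexp.
Proof.
  intros R. exists (exp (2 * Rabs R) * 3).
  pose proof (exp_pos (2 * Rabs R)). split; [lra|]. intros v h Hv Hh.
  pose proof (Rle_abs R). pose proof (Rabs_pos R).
  pose proof (re_le_Cmod v). pose proof (re_le_Cmod h). pose proof (Rle_abs (Re v)).
  assert (Cmod (cexp v) <= exp (2 * Rabs R) * 3).
  { rewrite Cmod_cexp. pose proof (exp_le (Re v) (2 * Rabs R) ltac:(lra)). lra. }
  repeat split; auto.
  rewrite cexp_plus.
  replace (cexp v * cexp h - cexp v - h * cexp v)%C with (cexp v * (cexp h - 1 - h))%C by ring.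
  pose proof (cexp_taylor_bound h). pose proof (Cmod_ge_0 h).
  apply Rle_trans with (exp (Re v) * (3 * exp (Rabs (Re h)) * (Cmod h * Cmod h))).
  - apply Cmod_prod_le; auto. rewrite Cmod_cexp. lra.
  - replace (exp (Re v) * (3 * exp (Rabs (Re h)) * (Cmod h * Cmod h)))
      with (exp (Re v + Rabs (Re h)) * 3 * (Cmod h * Cmod h)) by (rewrite exp_plus; ring).
    apply Rmult_le_compat_r; [nra|]. apply Rmult_le_compat_r; [lra|]. apply exp_le. lra.
Qed.

(** Add the expansion at [v] with step [h] to the expansion at [v + h] with step [- h]: the values
    of [f] cancel and [h (f' (v + h) - f' v)] remains. This yields the continuity of [f'] needed to
    integrate it. *)
Lemma hol_derive_lipschitz (f f' : C -> C) : hol f f' -> forall R, exists K, 0 <= K /\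
  forall v h, Cmod v <= R -> Cmod h <= R -> Cmod (f' (v + h) - f' v)%C <= K * Cmod h.
Proof.
  intros Hf R. destruct (Hf (2 * Rabs R)) as [K [HK H]]. exists (2 * K). split; [lra|].
  intros v h Hv Hh. pose proof (Rle_abs R). pose proof (Rabs_pos R).
  assert (Hvh : Cmod (v + h) <= 2 * Rabs R) by (eapply Rle_trans; [apply Cmod_triangle|]; lra).
  destruct (H v h ltac:(lra) ltac:(lra)) as [_ [_ c1]].
  destruct (H (v + h)%C (- h)%C Hvh ltac:(rewrite Cmod_opp; lra)) as [_ [_ c2]].
  rewrite Cmod_opp in c2. replace (v + h + - h)%C with v in c2 by ring.
  destruct (Req_dec (Cmod h) 0) as [E|E].
  - apply Cmod_eq_0 in E. subst h. replace (v + 0)%C with v by ring.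
    replace (f' v - f' v)%C with (RtoC 0) by ring. rewrite Cmod_0. nra.
  - pose proof (Cmod_ge_0 h).
    apply Rmult_le_reg_l with (Cmod h); [lra|]. rewrite <- Cmod_mult.
    replace (h * (f' (v + h) - f' v))%C with
      ((f (v + h) - f v - h * f' v) + (f v - f (v + h) - - h * f' (v + h)))%C by ring.
    replace (Cmod h * (2 * K * Cmod h)) with (K * (Cmod h * Cmod h) + K * (Cmod h * Cmod h)) by ring.
    apply Cmod_sum_le; auto.
Qed.

(* Chopping the segment from [0] to [w] into [n] steps costs [n * O(1/n^2)]. *)
Lemma quadratic_increment_constant (J : C -> C) :
  (forall R, exists K, 0 <= K /\ forall v h, Cmod v <= R -> Cmod h <= R ->
     Cmod (J (v + h) - J v)%C <= K * (Cmod h * Cmod h)) ->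
  forall w, J w = J 0.
Proof.
  intros H w. destruct (H (Cmod w)) as [K [HK HJ]].
  pose proof (Cmod_ge_0 w) as Hw.
  assert (Hn : forall n : nat, (0 < n)%nat -> Cmod (J w - J 0)%C * INR n <= K * (Cmod w * Cmod w)).
  { intros n Hn. assert (HINR : 0 < INR n) by (apply lt_0_INR; auto).
    assert (Cmod (RtoC (/ INR n)) = / INR n).
    { rewrite Cmod_R, Rabs_right; auto. left. apply Rinv_0_lt_compat; auto. }
    assert (Hk : forall k, (k <= n)%nat ->
      Cmod (J (INR k * / INR n * w) - J 0)%C <= INR k * (K * (Cmod w * Cmod w) * (/ INR n * / INR n))).
    { induction k as [|k IH]; intros Hk.
      - simpl. replace (0 * / INR n * w)%C with (RtoC 0) by ring.
        replace (J 0 - J 0)%C with (RtoC 0) by ring. rewrite Cmod_0. lra.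
      - rewrite S_INR, RtoC_plus.
        replace ((INR k + 1) * / INR n * w)%C with (INR k * / INR n * w + / INR n * w)%C by ring.
        replace (J (INR k * / INR n * w + / INR n * w) - J 0)%C with
          ((J (INR k * / INR n * w) - J 0) + (J (INR k * / INR n * w + / INR n * w) - J (INR k * / INR n * w)))%C by ring.
        rewrite Rmult_plus_distr_r, Rmult_1_l. apply Cmod_sum_le; [apply IH; lia|].
        assert (Hinv : (/ INR n)%C = RtoC (/ INR n)) by (rewrite RtoC_inv; auto; lra).
        rewrite !Hinv.
        assert (INR k * / INR n <= 1).
        { apply Rmult_le_reg_r with (INR n); auto. rewrite Rmult_assoc, Rinv_l by lra.
          assert (INR k <= INR n) by (apply le_INR; lia). lra. }
        pose proof (pos_INR k). assert (0 < / INR n) by (apply Rinv_0_lt_compat; auto).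
        assert (/ INR n <= 1).
        { rewrite <- Rinv_1. apply Rinv_le_contravar; [lra|]. replace 1 with (INR 1) by auto. apply le_INR; lia. }
        eapply Rle_trans; [apply HJ|].
        + rewrite <- RtoC_mult, Cmod_mult, Cmod_R, Rabs_right by nra. nra.
        + rewrite Cmod_mult, H0. nra.
        + rewrite Cmod_mult, H0. right; ring. }
    specialize (Hk n ltac:(lia)).
    replace (INR n * / INR n * w)%C with w in Hk by (field; intros E; apply RtoC_inj in E; lra).
    apply Rmult_le_compat_r with (r := INR n) in Hk; [|lra].
    eapply Rle_trans; [exact Hk|]. right. field. lra. }
  assert (Cmod (J w - J 0)%C <= 0).
  { destruct (Rle_dec (Cmod (J w - J 0)%C) 0) as [?|Hp]; auto. exfalso.
    apply Rnot_le_lt in Hp.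
    destruct (INR_archimed (Cmod (J w - J 0)%C) (K * (Cmod w * Cmod w)) Hp) as [n Hn'].
    destruct n as [|n]; [simpl in Hn'; nra|].
    specialize (Hn (S n) ltac:(lia)). lra. }
  assert (E : Cmod (J w - J 0)%C = 0) by (pose proof (Cmod_ge_0 (J w - J 0)%C); lra).
  apply Cmod_eq_0 in E. replace (J w) with (J w - J 0 + J 0)%C by ring. rewrite E. ring.
Qed.

(** * Integrals over the unit interval *)

Definition rcont (f : R -> C) : Prop :=
  forall x : R, continuous (fun t => Re (f t)) x /\ continuous (fun t => Im (f t)) x.

Definition cint (f : R -> C) : C :=
  (RInt (fun t => Re (f t)) 0 1, RInt (fun t => Im (f t)) 0 1).

Lemma rcont_const (c : C) : rcont (fun _ => c).
Proof. split; apply continuous_const. Qed.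

Lemma rcont_plus (f g : R -> C) : rcont f -> rcont g -> rcont (fun t => f t + g t)%C.
Proof.
  intros Hf Hg x. destruct (Hf x), (Hg x). split.
  - apply (continuous_plus (fun t => Re (f t)) (fun t => Re (g t))); auto.
  - apply (continuous_plus (fun t => Im (f t)) (fun t => Im (g t))); auto.
Qed.

Lemma rcont_mult (f g : R -> C) : rcont f -> rcont g -> rcont (fun t => f t * g t)%C.
Proof.
  intros Hf Hg x. destruct (Hf x), (Hg x). split.
  - apply (continuous_minus (fun t => Re (f t) * Re (g t)) (fun t => Im (f t) * Im (g t)));
      [apply (continuous_mult (fun t => Re (f t)) (fun t => Re (g t)))
      |apply (continuous_mult (fun t => Im (f t)) (fun t => Im (g t)))]; auto.
  - apply (continuous_plus (fun t => Re (f t) * Im (g t)) (fun t => Im (f t) * Re (g t)));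
      [apply (continuous_mult (fun t => Re (f t)) (fun t => Im (g t)))
      |apply (continuous_mult (fun t => Im (f t)) (fun t => Re (g t)))]; auto.
Qed.

Lemma ex_RInt_continuous_01 (f : R -> R) : (forall x, continuous f x) -> ex_RInt f 0 1.
Proof. intros H. apply (ex_RInt_continuous (V := R_CompleteNormedModule)). auto. Qed.

Lemma cint_ext (f g : R -> C) : (forall x, f x = g x) -> cint f = cint g.
Proof. intros H. replace g with f; auto. apply functional_extensionality; auto. Qed.

Lemma cint_const (c : C) : cint (fun _ => c) = c.
Proof.
  unfold cint. rewrite !RInt_const. destruct c; unfold scal; simpl; unfold mult; simpl.
  f_equal; ring.
Qed.

Lemma cint_plus (f g : R -> C) : rcont f -> rcont g ->
  cint (fun t => f t + g t)%C = (cint f + cint g)%C.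
Proof.
  intros Hf Hg. unfold cint, Cplus; simpl.
  f_equal; apply (RInt_plus (V := R_CompleteNormedModule));
    apply ex_RInt_continuous_01; intros x; apply (Hf x) || apply (Hg x).
Qed.

Lemma cint_scal (c : C) (f : R -> C) : rcont f -> cint (fun t => c * f t)%C = (c * cint f)%C.
Proof.
  intros Hf.
  assert (H1 : ex_RInt (fun t => Re (f t)) 0 1) by (apply ex_RInt_continuous_01; intros x; apply (Hf x)).
  assert (H2 : ex_RInt (fun t => Im (f t)) 0 1) by (apply ex_RInt_continuous_01; intros x; apply (Hf x)).
  assert (Hs : forall k (g : R -> R), ex_RInt g 0 1 -> ex_RInt (fun t => k * g t) 0 1)
    by (intros k g Hg; apply (ex_RInt_scal (V := R_NormedModule) g 0 1 k Hg)).
  assert (Hs' : forall k (g : R -> R), ex_RInt g 0 1 -> RInt (fun t => k * g t) 0 1 = k * RInt g 0 1)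
    by (intros k g Hg; apply (RInt_scal (V := R_CompleteNormedModule) g 0 1 k Hg)).
  destruct c as [a b]. unfold cint, Cmult; simpl. f_equal.
  - rewrite <- (Hs' a), <- (Hs' b) by auto.
    apply (RInt_minus (V := R_CompleteNormedModule)
      (fun t => a * Re (f t)) (fun t => b * Im (f t))); auto.
  - rewrite <- (Hs' a), <- (Hs' b) by auto.
    apply (RInt_plus (V := R_CompleteNormedModule)
      (fun t => a * Im (f t)) (fun t => b * Re (f t))); auto.
Qed.

(** The norm of [C] as a real normed space is [Cmod], so the vector-valued inequality applies to the
    pair of integrals, without the factor lost by treating the components separately. *)
Lemma Cmod_cint_le (f : R -> C) (g : R -> R) : rcont f -> (forall x, continuous g x) ->
  (forall x, 0 <= x <= 1 -> Cmod (f x) <= g x) -> Cmod (cint f) <= RInt g 0 1.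
Proof.
  intros Hf Hg Hle.
  assert (H1 : ex_RInt (fun t => Re (f t)) 0 1) by (apply ex_RInt_continuous_01; intros x; apply (Hf x)).
  assert (H2 : ex_RInt (fun t => Im (f t)) 0 1) by (apply ex_RInt_continuous_01; intros x; apply (Hf x)).
  assert (Hn : forall z : C, Cmod z = @norm _ C_R_NormedModule z).
  { intros [x y]. unfold norm; simpl. unfold prod_norm, Cmod; simpl.
    unfold norm; simpl. unfold abs; simpl. f_equal.
    rewrite !Rmult_1_r, <- !Rabs_mult, !Rabs_right by nra. reflexivity. }
  rewrite Hn. apply (norm_RInt_le (V := C_R_NormedModule) f g 0 1); [lra| | |].
  - intros x Hx. rewrite <- Hn. auto.
  - apply (is_RInt_fct_extend_pair (U := R_NormedModule) (V := R_NormedModule));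
      apply (RInt_correct (V := R_CompleteNormedModule)); auto.
  - apply (RInt_correct (V := R_CompleteNormedModule)). apply ex_RInt_continuous_01; auto.
Qed.

Lemma is_derive_quadratic (g : R -> R) (x l K : R) :
  (forall h, Rabs h <= 1 -> Rabs (g (x + h) - g x - h * l) <= K * (h * h)) -> is_derive g x l.
Proof.
  intros H. apply is_derive_Reals. intros eps Heps.
  set (L := Rabs K + 1). assert (0 < L) by (unfold L; pose proof (Rabs_pos K); lra).
  assert (Hd : 0 < Rmin 1 (eps / L)).
  { apply Rmin_pos; [lra|]. apply Rdiv_lt_0_compat; lra. }
  exists (mkposreal _ Hd). intros h Hh0 Hh. simpl in Hh.
  pose proof (Rmin_l 1 (eps / L)). pose proof (Rmin_r 1 (eps / L)).
  replace ((g (x + h) - g x) / h - l) with ((g (x + h) - g x - h * l) / h) by (field; auto).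
  unfold Rdiv. rewrite Rabs_mult, Rabs_inv.
  assert (Hp : 0 < Rabs h) by (apply Rabs_pos_lt; auto).
  apply Rmult_lt_reg_r with (Rabs h); auto. rewrite Rmult_assoc, Rinv_l, Rmult_1_r by lra.
  eapply Rle_lt_trans; [apply H; lra|].
  replace (h * h) with (Rabs h * Rabs h) by (rewrite <- Rabs_mult; apply Rabs_right; nra).
  rewrite <- Rmult_assoc. apply Rmult_lt_compat_r; auto.
  apply Rle_lt_trans with (L * Rabs h).
  - apply Rmult_le_compat_r; [lra|]. unfold L. pose proof (Rle_abs K). lra.
  - apply Rlt_le_trans with (L * (eps / L)); [apply Rmult_lt_compat_l; lra|]. right; field; lra.
Qed.

Lemma continuous_lipschitz (g : R -> R) (x K : R) :
  (forall h, Rabs h <= 1 -> Rabs (g (x + h) - g x) <= K * Rabs h) -> continuous g x.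
Proof.
  intros H. apply continuity_pt_filterlim. intros eps Heps.
  set (L := Rabs K + 1). assert (0 < L) by (unfold L; pose proof (Rabs_pos K); lra).
  exists (Rmin 1 (eps / L)). split.
  { apply Rmin_pos; [lra|]. apply Rdiv_lt_0_compat; lra. }
  intros y [_ Hy]. simpl in *. unfold R_dist in *.
  pose proof (Rmin_l 1 (eps / L)). pose proof (Rmin_r 1 (eps / L)).
  replace y with (x + (y - x)) by ring. eapply Rle_lt_trans; [apply H; lra|].
  apply Rle_lt_trans with (L * Rabs (y - x)).
  - apply Rmult_le_compat_r; [apply Rabs_pos|]. unfold L. pose proof (Rle_abs K). lra.
  - apply Rlt_le_trans with (L * (eps / L)); [apply Rmult_lt_compat_l; lra|]. right; field; lra.
Qed.

Lemma hol_is_derive (f f' : C -> C) (w : C) (x : R) : hol f f' ->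
  is_derive (fun t : R => Re (f (t + w)%C)) x (Re (f' (x + w)%C)) /\
  is_derive (fun t : R => Im (f (t + w)%C)) x (Im (f' (x + w)%C)).
Proof.
  intros Hf. destruct (Hf (Rabs (Cmod (x + w)) + 1)) as [K [HK H]].
  assert (Hb : forall h : R, Rabs h <= 1 ->
    Cmod (f (RtoC (x + h) + w) - f (x + w) - h * f' (x + w))%C <= K * (h * h)).
  { intros h Hh. destruct (H (x + w)%C (RtoC h)) as [_ [_ c]].
    - pose proof (Rle_abs (Cmod (x + w))); lra.
    - rewrite Cmod_R. pose proof (Rabs_pos (Cmod (x + w))). lra.
    - rewrite Cmod_R, <- Rabs_mult, (Rabs_right (h * h)) in c by nra.
      rewrite RtoC_plus. replace (x + h + w)%C with (x + w + h)%C by ring. auto. }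
  split; apply is_derive_quadratic with K; intros h Hh;
    (eapply Rle_trans; [|exact (Hb h Hh)]);
    generalize (f (RtoC (x + h) + w)%C), (f (x + w)%C), (f' (x + w)%C); intros [a a2] [b b2] [c c2].
  - eapply Rle_trans; [|apply re_le_Cmod]. right; simpl; f_equal; ring.
  - eapply Rle_trans; [|apply Im_le_Cmod]. right; simpl; f_equal; ring.
Qed.

Lemma hol_rcont_derive (f f' : C -> C) (w : C) : hol f f' -> rcont (fun t => f' (t + w)%C).
Proof.
  intros Hf x. destruct (hol_derive_lipschitz _ _ Hf (Rabs (Cmod (x + w)) + 1)) as [K [HK H]].
  assert (Hb : forall h : R, Rabs h <= 1 ->
    Cmod (f' (RtoC (x + h) + w) - f' (x + w))%C <= K * Rabs h).
  { intros h Hh. rewrite <- Cmod_R.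
    rewrite RtoC_plus. replace (x + h + w)%C with (x + w + h)%C by ring. apply H.
    - pose proof (Rle_abs (Cmod (x + w))); lra.
    - rewrite Cmod_R. pose proof (Rabs_pos (Cmod (x + w))). lra. }
  split; apply continuous_lipschitz with K; intros h Hh;
    (eapply Rle_trans; [|exact (Hb h Hh)]);
    generalize (f' (RtoC (x + h) + w)%C), (f' (x + w)%C); intros [a a2] [b b2].
  - eapply Rle_trans; [|apply re_le_Cmod]. right; simpl; f_equal; ring.
  - eapply Rle_trans; [|apply Im_le_Cmod]. right; simpl; f_equal; ring.
Qed.

Lemma hol_rcont (f f' : C -> C) (w : C) : hol f f' -> rcont (fun t => f (t + w)%C).
Proof.
  intros Hf x. destruct (hol_is_derive f f' w x Hf) as [H1 H2].
  split; apply (ex_derive_continuous (K := R_AbsRing) (V := R_NormedModule)); eexists; eauto.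
Qed.

Lemma cint_derive (f f' : C -> C) (w : C) : hol f f' ->
  cint (fun t => f' (t + w)%C) = (f (1 + w) - f w)%C.
Proof.
  intros Hf.
  transitivity ((Re (f (1 + w)%C) - Re (f (0 + w)%C), Im (f (1 + w)%C) - Im (f (0 + w)%C)) : C).
  2:{ replace (0 + w)%C with w by ring. reflexivity. }
  unfold cint. f_equal; apply is_RInt_unique.
  - apply (is_RInt_derive (V := R_CompleteNormedModule) (fun t : R => Re (f (t + w)%C))); intros x _.
    + apply hol_is_derive; auto.
    + apply (hol_rcont_derive f f' w Hf x).
  - apply (is_RInt_derive (V := R_CompleteNormedModule) (fun t : R => Im (f (t + w)%C))); intros x _.
    + apply hol_is_derive; auto.
    + apply (hol_rcont_derive f f' w Hf x).
Qed.

(** Differentiating under the integral gives the integral of [G'] over a unit segment, which is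
    [G (w + 1) - G w = 0]. So the integral has quadratic increments in the complex variable [w] and
    is constant: lines at different heights have equal integrals. *)
Lemma cint_shift (G G' : C -> C) : hol G G' -> (forall v, G (v + 1)%C = G v) ->
  forall w, cint (fun t => G (t + w)%C) = cint (fun t => G t).
Proof.
  intros HG Hper w.
  rewrite (quadratic_increment_constant (fun w => cint (fun t => G (t + w)%C))).
  - apply cint_ext; intros t. f_equal; ring.
  - intros R. destruct (HG (Rabs R + 1)) as [K [HK H]]. exists K. split; auto.
    intros v h Hv Hh.
    (* The term [- h * G'] can be inserted because its integral vanishes by periodicity; it turns
       the integrand into the Taylor remainder of [G]. *)
    assert (E : (cint (fun t => G (t + (v + h))) - cint (fun t => G (t + v)))%C =
      cint (fun t => G (t + (v + h)) + ((- (1)) * G (t + v) + (- h) * G' (t + v)))%C).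
    { pose proof (hol_rcont G G' (v + h) HG) as r1. pose proof (hol_rcont G G' v HG) as r2.
      pose proof (hol_rcont_derive G G' v HG) as r3.
      assert (r4 : rcont (fun t => - (1) * G (t + v))%C) by (apply (rcont_mult _ _ (rcont_const _) r2)).
      assert (r5 : rcont (fun t => - h * G' (t + v))%C) by (apply (rcont_mult _ _ (rcont_const _) r3)).
      rewrite (cint_plus _ _ r1 (rcont_plus _ _ r4 r5)), (cint_plus _ _ r4 r5).
      rewrite !cint_scal by auto. rewrite (cint_derive G G' v HG).
      replace (1 + v)%C with (v + 1)%C by ring. rewrite Hper. ring. }
    rewrite E. replace (K * (Cmod h * Cmod h)) with (RInt (fun _ => K * (Cmod h * Cmod h)) 0 1).
    2:{ rewrite RInt_const. unfold scal; simpl; unfold mult; simpl. ring. }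
    apply Cmod_cint_le.
    + apply rcont_plus; [eapply hol_rcont; eauto|].
      apply rcont_plus; apply rcont_mult; try apply rcont_const;
       [eapply hol_rcont|eapply hol_rcont_derive]; eauto.
    + intros; apply continuous_const.
    + intros x Hx. pose proof (Rle_abs R). pose proof (Rabs_pos R).
      destruct (H (x + v)%C h) as [_ [_ c]].
      * rewrite Rplus_comm. apply Cmod_sum_le; [|lra]. rewrite Cmod_R, Rabs_right; lra.
      * lra.
      * eapply Rle_trans; [|exact c]. right; f_equal.
        replace (x + (v + h))%C with (x + v + h)%C by ring. ring.
Qed.

(** * Uniqueness of quasi-periodic functions *)

Definition fourier_char (n : Z) (v : C) : C := cexp (2 * PI * IZR n * Ci * v)%C.

Lemma fourier_char_plus (m n : Z) (v : C) :
  fourier_char (m + n) v = (fourier_char m v * fourier_char n v)%C.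
Proof. unfold fourier_char. rewrite plus_IZR, RtoC_plus, <- cexp_plus. f_equal. ring. Qed.

Lemma fourier_char_0 (v : C) : fourier_char 0 v = 1%C.
Proof. unfold fourier_char. rewrite <- cexp_0. f_equal. ring. Qed.

Lemma fourier_char_periodic (n : Z) (v : C) : fourier_char n (v + 1) = fourier_char n v.
Proof. apply cexp_eq_mod with n. ring. Qed.

Lemma hol_fourier_char (n : Z) :
  hol (fourier_char n) (fun v => 2 * PI * IZR n * Ci * fourier_char n v)%C.
Proof.
  eapply hol_ext; [| |exact (hol_comp _ _ _ _ (hol_scal (2 * PI * IZR n * Ci)%C _ _ hol_id) hol_cexp)];
    intros v; unfold fourier_char; simpl; ring.
Qed.

Lemma RtoC_neq_0 (x : R) : x <> 0 -> RtoC x <> 0%C.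
Proof. intros H E. apply H, RtoC_inj, E. Qed.

Lemma Ci_neq_0 : Ci <> 0%C.
Proof. intros E. apply (f_equal Im) in E. simpl in E. lra. Qed.

Lemma PI_neq_0_C : RtoC PI <> 0%C.
Proof. apply RtoC_neq_0, PI_neq0. Qed.

Lemma rcont_fourier_char (n : Z) : rcont (fun t : R => fourier_char n t).
Proof.
  replace (fun t : R => fourier_char n t) with (fun t : R => fourier_char n (t + 0)%C).
  - exact (hol_rcont _ _ 0 (hol_fourier_char n)).
  - apply functional_extensionality; intros t; f_equal; ring.
Qed.

Lemma cint_fourier_char (n : Z) :
  cint (fun t => fourier_char n t) = if Z.eqb n 0 then 1%C else 0%C.
Proof.
  destruct (Z.eqb_spec n 0) as [->|Hn].
  - rewrite <- (cint_const 1%C). apply cint_ext; intros; apply fourier_char_0.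
  - pose proof (cint_derive _ _ 0 (hol_fourier_char n)) as H.
    rewrite (cint_ext _ (fun t : R => 2 * PI * IZR n * Ci * fourier_char n t)%C) in H.
    2:{ intros t. repeat f_equal; ring. }
    rewrite cint_scal in H by apply rcont_fourier_char.
    replace (1 + 0)%C with (0 + 1)%C in H by ring.
    rewrite fourier_char_periodic in H.
    replace (fourier_char n 0 - fourier_char n 0)%C with (RtoC 0) in H by ring.
    destruct (Ceq_dec (cint (fun t => fourier_char n t)) 0%C) as [E|E]; auto.
    exfalso. revert H. repeat apply Cmult_neq_0; auto using PI_neq_0_C, Ci_neq_0.
    + apply RtoC_neq_0; lra.
    + apply RtoC_neq_0. apply not_0_IZR; auto.
Qed.

(** The sign [s] makes the complex conjugate on the real line another sum of the same kind, so that
    the squared modulus is a combination of characters and can be integrated by orthogonality. *)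
Fixpoint dirichlet (s : Z) (N : nat) (v : C) : C :=
  match N with
  | O => 0%C
  | S k => (dirichlet s k v + fourier_char (s * Z.of_nat k) v)%C
  end.

Lemma rcont_dirichlet (s : Z) (N : nat) : rcont (fun t : R => dirichlet s N t).
Proof.
  induction N as [|N IH]; simpl.
  - apply rcont_const.
  - apply rcont_plus; [exact IH|apply rcont_fourier_char].
Qed.

(* For real [t] the product [dirichlet 1 M t * dirichlet (-1) M t] is [|dirichlet 1 M t|^2], i.e. [M] times the Fejer kernel. *)
Lemma cint_fejer (G : R -> C) (g : C) : rcont G ->
  (forall n, cint (fun t => G t * fourier_char n t)%C = if Z.eqb n 0 then g else 0%C) ->
  forall M : nat,
    cint (fun t => G t * (dirichlet 1 M t * dirichlet (-1) M t))%C = (INR M * g)%C.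
Proof.
  intros HG Hc.
  assert (H1 : forall m N : nat,
    cint (fun t => G t * (dirichlet 1 N t * fourier_char (- Z.of_nat m) t))%C
     = if (m <? N)%nat then g else 0%C).
  { intros m N. induction N as [|N IH].
    - rewrite <- (cint_const 0%C). apply cint_ext; intros; simpl; ring.
    - rewrite (cint_ext _ (fun t : R => G t * (dirichlet 1 N t * fourier_char (- Z.of_nat m) t)
                 + G t * fourier_char (Z.of_nat N - Z.of_nat m) t)%C).
      2:{ intros t. change (dirichlet 1 (S N) t) with (dirichlet 1 N t + fourier_char (1 * Z.of_nat N) t)%C.
          unfold Z.sub. rewrite Z.mul_1_l, fourier_char_plus. ring. }
      rewrite cint_plus, IH, Hc.
      + destruct (Nat.ltb_spec m N), (Nat.ltb_spec m (S N)), (Z.eqb_spec (Z.of_nat N - Z.of_nat m) 0);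
          try lia; ring.
      + repeat apply rcont_mult; auto using rcont_dirichlet, rcont_fourier_char.
      + apply rcont_mult; auto using rcont_fourier_char. }
  (* The two lengths are kept apart so that the induction lengthens one factor while the other stays
     fixed. As long as [M < N], each new character meets its inverse exactly once. *)
  assert (H2 : forall M N : nat, (M <= N)%nat ->
    cint (fun t => G t * (dirichlet 1 N t * dirichlet (-1) M t))%C = (INR M * g)%C).
  { intros M N. induction M as [|M IH]; intros HM.
    - simpl. transitivity (cint (fun _ => 0%C)); [|rewrite cint_const; ring].
      apply cint_ext; intros; simpl; ring.
    - rewrite (cint_ext _ (fun t : R => G t * (dirichlet 1 N t * dirichlet (-1) M t)
           + G t * (dirichlet 1 N t * fourier_char (- Z.of_nat M) t))%C).
      2:{ intros t. change (dirichlet (-1) (S M) t) with (dirichlet (-1) M t + fourier_char (-1 * Z.of_nat M) t)%C.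
          replace (-1 * Z.of_nat M)%Z with (- Z.of_nat M)%Z by ring. ring. }
      rewrite cint_plus, IH, H1, S_INR, RtoC_plus by
        (try lia; repeat apply rcont_mult; auto using rcont_dirichlet, rcont_fourier_char).
      destruct (Nat.ltb_spec M N); try lia. ring. }
  intros M. apply H2. lia.
Qed.

Lemma fourier_char_conj (n : Z) (t : R) : fourier_char (- n) t = Cconj (fourier_char n t).
Proof.
  unfold fourier_char, cexp, Cconj. rewrite opp_IZR. simpl.
  match goal with |- (exp ?a * cos ?b, exp ?a * sin ?b) = (exp ?c * cos ?d, - (exp ?c * sin ?d)) =>
    replace a with c by ring; replace b with (- d) by ring end.
  rewrite cos_neg, sin_neg. f_equal; ring.
Qed.

Lemma dirichlet_conj (N : nat) (t : R) : dirichlet (-1) N t = Cconj (dirichlet 1 N t).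
Proof.
  induction N as [|N IH].
  - simpl. unfold Cconj; simpl. unfold RtoC. f_equal; ring.
  - change (dirichlet (-1) (S N) t) with (dirichlet (-1) N t + fourier_char (-1 * Z.of_nat N) t)%C.
    change (dirichlet 1 (S N) t) with (dirichlet 1 N t + fourier_char (1 * Z.of_nat N) t)%C.
    replace (-1 * Z.of_nat N)%Z with (- (1 * Z.of_nat N))%Z by ring.
    rewrite IH, fourier_char_conj. unfold Cconj, Cplus; simpl. f_equal; ring.
Qed.

Lemma dirichlet_geom (N : nat) (v : C) :
  ((fourier_char 1 v - 1) * dirichlet 1 N v = fourier_char (Z.of_nat N) v - 1)%C.
Proof.
  induction N as [|N IH].
  - simpl. rewrite fourier_char_0. ring.
  - change (dirichlet 1 (S N) v) with (dirichlet 1 N v + fourier_char (1 * Z.of_nat N) v)%C.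
    rewrite Cmult_plus_distr_l, IH, Z.mul_1_l, Nat2Z.inj_succ, <- Z.add_1_l, fourier_char_plus. ring.
Qed.

Lemma Cmod_fourier_char (n : Z) (t : R) : Cmod (fourier_char n t) = 1.
Proof.
  unfold fourier_char. rewrite Cmod_cexp. rewrite <- exp_0. f_equal. simpl. ring.
Qed.

(** Below [1/2] the quadratic bound gives [sin y >= y - y^2 >= y / 2]. Above, monotonicity gives
    [sin y >= sin (1/2) >= 1/4], and [y / 8 <= 1/4] because [PI <= 4]. *)
Lemma sin_ge_eighth (y : R) : 0 <= y <= PI / 2 -> y / 8 <= sin y.
Proof.
  intros Hy. pose proof PI_4. pose proof PI2_3_2.
  destruct (Rle_dec y (1 / 2)) as [Hy2|Hy2].
  - pose proof (sin_taylor_bound y) as Hb. apply Rabs_le_between in Hb. nra.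
  - apply Rle_trans with (sin (1 / 2)).
    + pose proof (sin_taylor_bound (1 / 2)) as Hb. apply Rabs_le_between in Hb. lra.
    + apply sin_incr_1; lra.
Qed.

(** The modulus equals [2 sin (PI t)], and [Rmin t (1 - t)] is the distance to the nearest integer.
    So a periodic Lipschitz function that vanishes at [0] is dominated by [|e_1 - 1|]. *)
Lemma Cmod_fourier_char_1_minus_1 (t : R) :
  0 <= t <= 1 -> Rmin t (1 - t) / 8 <= Cmod (fourier_char 1 t - 1)%C.
Proof.
  intros Ht.
  assert (Hsin : Rmin t (1 - t) / 8 <= sin (PI * t)).
  { pose proof PI_4. pose proof PI2_3_2.
    assert (Hs : forall s, 0 <= s <= 1 / 2 -> s / 8 <= sin (PI * s)).
    { intros s Hs0. eapply Rle_trans; [|apply sin_ge_eighth; nra]. nra. }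
    destruct (Rle_dec t (1 / 2)).
    - rewrite Rmin_left by lra. apply Hs. lra.
    - rewrite Rmin_right by lra. replace (PI * t) with (PI - PI * (1 - t)) by ring.
      rewrite sin_PI_x. apply Hs. lra. }
  assert (Hre : fourier_char 1 t = (cos (2 * (PI * t)), sin (2 * (PI * t)))).
  { unfold fourier_char, cexp; simpl.
    match goal with |- (exp ?a * cos ?b, _) = _ =>
      replace a with 0 by ring; replace b with (2 * (PI * t)) by ring end.
    rewrite exp_0. f_equal; ring. }
  assert (Hsq : Cmod (fourier_char 1 t - 1) ^ 2 = (2 * sin (PI * t)) ^ 2).
  { rewrite Hre, Cmod2_alt.
    pose proof (sin2_cos2 (2 * (PI * t))) as Hcs. unfold Rsqr in Hcs.
    pose proof (cos_2a_sin (PI * t)) as Hc2. simpl. nra. }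
  assert (0 <= Rmin t (1 - t)) by (apply Rmin_glb; lra).
  pose proof (Cmod_ge_0 (fourier_char 1 t - 1)%C).
  assert (2 * sin (PI * t) <= Cmod (fourier_char 1 t - 1)%C); [|lra].
  apply Rsqr_incr_0_var; auto. unfold Rsqr. nra.
Qed.

(** The only nonzero coefficient of [D = G - G 0] is its mean [- G 0], so integrating [D] against
    [N] times the Fejer kernel gives [- N * G 0]. The kernel concentrates at the integers, where [D]
    vanishes to first order, and this limits the same integral to the order of the square root of
    [N]. *)
Lemma fourier_uniqueness (G G' : C -> C) : hol G G' -> (forall v, G (v + 1)%C = G v) ->
  (forall n, cint (fun t => G t * fourier_char n t)%C = 0%C) -> G 0 = 0%C.
Proof.
  intros HG Hper Hc.
  assert (rG : rcont (fun t : R => G t)).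
  { replace (fun t : R => G t) with (fun t : R => G (t + 0)%C)
      by (apply functional_extensionality; intros; f_equal; ring). eapply hol_rcont; eauto. }
  set (D := fun t : R => (G t + - G 0)%C).
  assert (rD : rcont D) by (apply rcont_plus; [exact rG|apply rcont_const]).
  assert (HD : forall M, cint (fun t => D t * (dirichlet 1 M t * dirichlet (-1) M t))%C = (INR M * - G 0)%C).
  { apply cint_fejer; auto. intros n. unfold D.
    rewrite (cint_ext _ (fun t : R => G t * fourier_char n t + - G 0 * fourier_char n t)%C) by (intros; ring).
    rewrite cint_plus, cint_scal, Hc, cint_fourier_char;
      try apply rcont_mult; auto using rcont_fourier_char, rcont_const.
    destruct (n =? 0)%Z; ring. }
  assert (H1 : forall M, cint (fun t => 1 * (dirichlet 1 M t * dirichlet (-1) M t))%C = INR M).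
  { intros M. rewrite (cint_fejer (fun _ => 1%C) 1%C); [ring|apply rcont_const|].
    intros n. rewrite <- cint_fourier_char. apply cint_ext; intros; ring. }
  destruct (hol_increment _ _ HG 1) as [K [HK HI]].
  assert (Hlip : forall t : R, 0 <= t <= 1 -> Cmod (D t) <= 8 * K * Cmod (fourier_char 1 t - 1)%C).
  { intros t Ht. pose proof (Cmod_fourier_char_1_minus_1 t Ht) as Hm.
    assert (Cmod (D t) <= K * Rmin t (1 - t)); [|nra].
    destruct (Rle_dec t (1 / 2)).
    - rewrite Rmin_left by lra.
      pose proof (HI 0%C (RtoC t) ltac:(rewrite Cmod_0; lra) ltac:(rewrite Cmod_R, Rabs_right; lra)) as h.
      rewrite Cmod_R, Rabs_right in h by lra. replace (0 + t)%C with (RtoC t) in h by ring. exact h.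
    (* Near the right end the increment is taken from [1], where [G] has the value [G 0] by
       periodicity. *)
    - rewrite Rmin_right by lra.
      pose proof (HI 1%C (RtoC (t - 1)) ltac:(rewrite Cmod_1; lra) ltac:(rewrite Cmod_R, Rabs_left1; lra)) as h.
      rewrite Cmod_R, Rabs_left1 in h by lra. rewrite RtoC_minus in h.
      replace (1 + (t - 1))%C with (RtoC t) in h by ring.
      replace (G 1%C) with (G 0%C) in h by (rewrite <- (Hper 0%C); f_equal; ring).
      unfold D. replace (1 - t) with (- (t - 1)) by ring. exact h. }
  assert (Hmain : forall m : nat, Cmod (G 0) * INR m <= 8 * K * 2).
  { intros m. destruct m as [|m]; [simpl; lra|]. set (a := INR (S m)).
    assert (Ha : 0 < a) by (apply lt_0_INR; lia).
    (* A square length makes the AM-GM weight [a] the exact square root of [N]: the comparison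
       becomes [|G 0| a^2 <= 16 K a]. *)
    specialize (HD (S m * S m)%nat). specialize (H1 (S m * S m)%nat).
    set (N := (S m * S m)%nat) in *.
    assert (HN : INR N = a * a) by (unfold N, a; rewrite <- mult_INR; auto).
    set (F2 := fun t : R => Re (1 * (dirichlet 1 N t * dirichlet (-1) N t))%C).
    assert (HF2 : forall t, F2 t = Cmod (dirichlet 1 N t) ^ 2).
    { intros t. unfold F2. rewrite dirichlet_conj, <- Cmod2_conj, Cmult_1_l. reflexivity. }
    assert (cF2 : forall x, continuous F2 x).
    { intros x. apply (rcont_mult _ _ (rcont_const 1%C) (rcont_mult _ _ (rcont_dirichlet 1 N) (rcont_dirichlet (-1) N)) x). }
    assert (IF2 : RInt F2 0 1 = a * a).
    { apply (f_equal Re) in H1. rewrite <- HN. exact H1. }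
    (* AM-GM: |e_1 - 1| |E|^2 <= |E|^2 / a + a |(e_1 - 1) E|^2 / 4 with |(e_1 - 1) E| = |e_N - 1| <= 2 *)
    assert (Hle : Cmod (cint (fun t => D t * (dirichlet 1 N t * dirichlet (-1) N t))%C)
             <= RInt (fun t => 8 * K * (/ a * F2 t + a)) 0 1).
    { apply Cmod_cint_le.
      - apply rcont_mult; auto. apply rcont_mult; apply rcont_dirichlet.
      - intros x. apply (continuous_scal_r (K := R_AbsRing) (V := R_NormedModule) (8 * K)).
        apply (continuous_plus (V := R_NormedModule)); [|apply continuous_const].
        apply (continuous_scal_r (K := R_AbsRing) (V := R_NormedModule) (/ a)). apply cF2.
      - intros t Ht. rewrite dirichlet_conj, <- Cmod2_conj.
        rewrite Cmod_mult, HF2.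
        assert (Hg : Cmod (fourier_char 1 t - 1) * Cmod (dirichlet 1 N t) <= 2).
        { rewrite <- Cmod_mult, dirichlet_geom. replace 2 with (1 + 1) by ring.
          apply Cmod_sum_le; [rewrite Cmod_fourier_char; lra|rewrite Cmod_opp, Cmod_1; lra]. }
        specialize (Hlip t Ht).
        pose proof (Cmod_ge_0 (fourier_char 1 t - 1)%C). pose proof (Cmod_ge_0 (dirichlet 1 N t)).
        set (E := Cmod (dirichlet 1 N t)) in *. set (u := Cmod (fourier_char 1 t - 1)%C) in *.
        replace (Cmod (RtoC (E ^ 2)%R)) with (E ^ 2) by (rewrite Cmod_R, Rabs_right; auto; nra).
        apply Rle_trans with (8 * K * u * E ^ 2); [apply Rmult_le_compat_r; nra|].
        rewrite Rmult_assoc. apply Rmult_le_compat_l; [lra|].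
        assert (0 <= u * E) by nra.
        apply Rmult_le_reg_l with a; auto.
        replace (a * (/ a * E ^ 2 + a)) with (E ^ 2 + a * a) by (field; lra).
        apply Rle_trans with (a * E * 2).
        + replace (a * (u * E ^ 2)) with (a * E * (u * E)) by ring.
          apply Rmult_le_compat_l; nra.
        + pose proof (pow2_ge_0 (E - a)). nra. }
    rewrite HD, Cmod_mult, Cmod_opp, Cmod_R, HN, Rabs_right in Hle by nra.
    assert (E : RInt (fun t => 8 * K * (/ a * F2 t + a)) 0 1 = 8 * K * (2 * a)).
    { assert (eF : ex_RInt F2 0 1) by (apply ex_RInt_continuous_01; auto).
      assert (eF' : ex_RInt (fun t => / a * F2 t) 0 1) by (apply (ex_RInt_scal (V := R_NormedModule) F2 0 1 (/ a)); auto).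
      assert (Hs : forall k (g : R -> R), ex_RInt g 0 1 -> RInt (fun t => k * g t) 0 1 = k * RInt g 0 1)
        by (intros k g Hg; apply (RInt_scal (V := R_CompleteNormedModule) g 0 1 k Hg)).
      assert (eFa : ex_RInt (fun t => / a * F2 t + a) 0 1)
        by (apply (ex_RInt_plus (V := R_NormedModule)); auto; apply ex_RInt_const).
      rewrite Hs by auto. f_equal.
      transitivity (RInt (fun t => / a * F2 t) 0 1 + RInt (fun _ => a) 0 1).
      { apply (RInt_plus (V := R_CompleteNormedModule) (fun t => / a * F2 t) (fun _ => a)); auto.
        apply ex_RInt_const. }
      rewrite Hs, RInt_const, IF2 by auto. unfold scal; simpl; unfold mult; simpl. field. lra. }
    rewrite E in Hle. apply Rmult_le_reg_l with a; auto. lra. }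
  destruct (Req_dec (Cmod (G 0)) 0) as [E|E]; [apply Cmod_eq_0; auto|exfalso].
  pose proof (Cmod_ge_0 (G 0)).
  destruct (INR_archimed (Cmod (G 0)) (8 * K * 2) ltac:(lra)) as [m Hm].
  specialize (Hmain m). lra.
Qed.

Lemma quasi_periodic_uniqueness (tau lam : C) (G G' : C -> C) :
  lam <> 0%C -> hol G G' -> (forall v, G (v + 1)%C = G v) ->
  (forall v, G (v + tau)%C = lam * fourier_char (-1) v * G v)%C ->
  cint (fun t => G t) = 0%C -> forall v, G v = 0%C.
Proof.
  intros Hlam HG Hper Hq H0 w.
  set (a := fun n => cint (fun t : R => G t * fourier_char n t)%C).
  assert (rG : forall w, rcont (fun t : R => G (t + w)%C)) by (intros; eapply hol_rcont; eauto).
  assert (rG0 : rcont (fun t : R => G t)).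
  { replace (fun t : R => G t) with (fun t : R => G (t + 0)%C); auto.
    apply functional_extensionality; intros; f_equal; ring. }
  assert (Hsh : forall n w, cint (fun t : R => G (t + w) * fourier_char n (t + w))%C = a n).
  { intros n w'. unfold a.
    apply (cint_shift (fun v => G v * fourier_char n v)%C _ (hol_mult _ _ _ _ HG (hol_fourier_char n))).
    intros v. rewrite Hper, fourier_char_periodic. auto. }
  assert (Hadd : forall n v w, fourier_char n (v + w)%C = (fourier_char n v * fourier_char n w)%C).
  { intros. unfold fourier_char. rewrite <- cexp_plus. f_equal. ring. }
  (* Raising the line by [tau] lowers the index by one with a nonzero multiplier, so the vanishing
     of the mean spreads to all indices in both directions. *)
  assert (Hrec : forall n, a n = (lam * fourier_char n tau * a (n + -1)%Z)%C).
  { intros n. rewrite <- (Hsh n tau). unfold a.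
    rewrite <- cint_scal by (apply rcont_mult; auto using rcont_fourier_char).
    apply cint_ext; intros t. rewrite Hq, Hadd, fourier_char_plus. ring. }
  assert (Ha : forall n, a n = 0%C).
  { assert (Ha0 : a 0%Z = 0%C).
    { rewrite <- H0. apply cint_ext; intros; rewrite fourier_char_0; ring. }
    apply Z.bi_induction; [intros x y ->; tauto|auto|].
    intros n. specialize (Hrec (Z.succ n)). replace (Z.succ n + -1)%Z with n in Hrec by lia.
    split; intros E.
    - rewrite Hrec, E. ring.
    - rewrite Hrec in E. destruct (Ceq_dec (a n) 0%C) as [?|Hn]; auto. exfalso.
      revert E. repeat apply Cmult_neq_0; auto. apply cexp_neq_0. }
  (* [fourier_uniqueness] gives a value at [0] only, so it is applied to the translate of [G] by
     [w]; its coefficients differ from [a n] by the nonzero factor [fourier_char n w]. *)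
  replace (G w) with (G (0 + w)%C) by (f_equal; ring).
  assert (Hw : hol (fun v => v + w)%C (fun _ => 1 + 0)%C) by (apply hol_plus; [apply hol_id|apply hol_const]).
  apply (fourier_uniqueness (fun v => G (v + w)%C) _ (hol_comp _ _ _ _ Hw HG)).
  - intros v. replace (v + 1 + w)%C with (v + w + 1)%C by ring. apply Hper.
  - intros n. pose proof (Hsh n w) as E. rewrite Ha in E.
    rewrite (cint_ext _ (fun t : R => fourier_char n w * (G (t + w) * fourier_char n t))%C) in E
      by (intros; rewrite Hadd; ring).
    rewrite cint_scal in E by (apply rcont_mult; auto using rcont_fourier_char).
    destruct (Ceq_dec (cint (fun t : R => G (t + w) * fourier_char n t)%C) 0%C) as [?|Hn]; auto. exfalso.
    revert E. apply Cmult_neq_0; auto. apply cexp_neq_0.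
Qed.

(** * The theta series *)

Lemma CSeries_unique (a : nat -> C) (l : C) : is_series a l -> CSeries a = l.
Proof.
  intros H. unfold CSeries.
  apply (@iota_filterlim_locally C_AbsRing C_CompleteNormedModule _ eventually _ (sum_n a) l H).
Qed.

Lemma is_series_unique_C (a : nat -> C) (l m : C) : is_series a l -> is_series a m -> l = m.
Proof. intros H1 H2. rewrite <- (CSeries_unique a l H1). apply CSeries_unique; auto. Qed.

Lemma is_series_Cmod_le (a : nat -> C) (b : nat -> R) (l : C) (B : R) :
  (forall k, Cmod (a k) <= b k) -> is_series a l -> is_series b B -> Cmod l <= B.
Proof.
  intros H Ha Hb.
  apply (is_lim_seq_le (fun n => Cmod (sum_n a n)) (sum_n b) (Cmod l) B).
  - intros n. unfold sum_n.
    eapply Rle_trans; [apply (@norm_sum_n_m C_AbsRing C_NormedModule)|].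
    apply sum_n_m_le; auto.
  - exact (filterlim_comp _ _ _ _ _ _ _ _ Ha (@filterlim_norm C_AbsRing C_NormedModule l)).
  - exact Hb.
Qed.

Lemma ex_series_Cmod_le (a : nat -> C) (b : nat -> R) :
  (forall k, Cmod (a k) <= b k) -> ex_series b -> is_series a (CSeries a).
Proof.
  intros H Hb.
  destruct (@ex_series_le C_AbsRing C_CompleteNormedModule a b H Hb) as [l Hl].
  rewrite (CSeries_unique a l Hl). exact Hl.
Qed.

Lemma is_series_plus_C (a b : nat -> C) (l m : C) :
  is_series a l -> is_series b m -> is_series (fun k => a k + b k)%C (l + m)%C.
Proof. exact (is_series_plus (K := C_AbsRing) (V := C_NormedModule) a b l m). Qed.

Lemma is_series_scal_C (c : C) (a : nat -> C) (l : C) :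
  is_series a l -> is_series (fun k => c * a k)%C (c * l)%C.
Proof. exact (is_series_scal (K := C_AbsRing) (V := C_NormedModule) c a l). Qed.

Lemma is_series_incr_1_C (a : nat -> C) (l : C) :
  is_series a l -> is_series (fun k => a (S k)) (l - a O)%C.
Proof.
  intros H. apply (is_series_incr_1 (K := C_AbsRing) (V := C_NormedModule)).
  change (is_series a (l - a O + a O)%C). replace (l - a O + a O)%C with l by ring. exact H.
Qed.

Lemma is_series_decr_1_C (a : nat -> C) (l : C) :
  is_series (fun k => a (S k)) l -> is_series a (l + a O)%C.
Proof.
  intros H. apply (is_series_decr_1 (K := C_AbsRing) (V := C_NormedModule)).
  change (is_series (fun k => a (S k)) (l + a O + - a O)%C).
  replace (l + a O + - a O)%C with l by ring. exact H.
Qed.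

(** The remainder of one term is [c e^(b v) (e^(b h) - 1 - b h)], quadratic in [h] at the cost of
    [|b|^2] and a second exponential. The factor [1 + |b| + |b|^2] in the majorant pays for value,
    derivative and remainder together. *)
Lemma hol_series (c b : nat -> C) (M : R -> nat -> R) :
  (forall r, 0 <= r -> ex_series (M r)) ->
  (forall r k, 0 <= r ->
     Cmod (c k) * (1 + Cmod (b k) + Cmod (b k) * Cmod (b k)) * exp (Cmod (b k) * r) <= M r k) ->
  exists f f', hol f f' /\
    (forall v, is_series (fun k => c k * cexp (b k * v))%C (f v)) /\
    (forall v, is_series (fun k => b k * (c k * cexp (b k * v)))%C (f' v)).
Proof.
  intros HM Hle.
  assert (Hexp : forall k v r, Cmod v <= r -> Cmod (cexp (b k * v)) <= exp (Cmod (b k) * r)).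
  { intros k v r Hv. rewrite Cmod_cexp. apply exp_le.
    eapply Rle_trans; [apply Rle_abs|]. eapply Rle_trans; [apply re_le_Cmod|].
    rewrite Cmod_mult. apply Rmult_le_compat_l; auto using Cmod_ge_0. }
  assert (H0 : forall r k v, 0 <= r -> Cmod v <= r -> Cmod (c k * cexp (b k * v)) <= M r k).
  { intros r k v Hr Hv. eapply Rle_trans; [|apply Hle; auto].
    pose proof (Cmod_ge_0 (c k)). pose proof (Cmod_ge_0 (b k)).
    apply Cmod_prod_le; auto.
    rewrite <- (Rmult_1_r (Cmod (c k))) at 1. apply Rmult_le_compat_l; nra. }
  assert (H1 : forall r k v, 0 <= r -> Cmod v <= r -> Cmod (b k * (c k * cexp (b k * v))) <= M r k).
  { intros r k v Hr Hv. eapply Rle_trans; [|apply Hle; auto].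
    pose proof (Cmod_ge_0 (c k)). pose proof (Cmod_ge_0 (b k)).
    replace (b k * (c k * cexp (b k * v)))%C with ((c k * b k) * cexp (b k * v))%C by ring.
    apply Cmod_prod_le; auto. rewrite Cmod_mult.
    apply Rmult_le_compat_l; nra. }
  set (f := fun v => CSeries (fun k => c k * cexp (b k * v))%C).
  set (f' := fun v => CSeries (fun k => b k * (c k * cexp (b k * v)))%C).
  assert (Hf : forall v, is_series (fun k => c k * cexp (b k * v))%C (f v)).
  { intros v. apply ex_series_Cmod_le with (M (Cmod v)); [|apply HM, Cmod_ge_0].
    intros k. apply H0; [apply Cmod_ge_0|lra]. }
  assert (Hf' : forall v, is_series (fun k => b k * (c k * cexp (b k * v)))%C (f' v)).
  { intros v. apply ex_series_Cmod_le with (M (Cmod v)); [|apply HM, Cmod_ge_0].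
    intros k. apply H1; [apply Cmod_ge_0|lra]. }
  exists f, f'. split; [|split]; auto.
  intros R. pose proof (Rabs_pos R) as HR. pose proof (Rle_abs R) as HR'.
  (* The radius is doubled since [e^(b v)] and the remainder in [h] each contribute
     [exp (|b| * Rabs R)]. *)
  destruct (HM (2 * Rabs R) ltac:(lra)) as [S HS].
  assert (HS0 : 0 <= S).
  { eapply Rle_trans; [apply Cmod_ge_0|].
    apply (is_series_Cmod_le _ (M (2 * Rabs R)) _ S (fun k => H0 (2 * Rabs R) k 0%C ltac:(lra) ltac:(rewrite Cmod_0; lra)) (Hf 0%C) HS). }
  exists (3 * S). split; [lra|]. intros v h Hv Hh.
  repeat split.
  - apply Rle_trans with S; [|lra].
    apply (is_series_Cmod_le _ (M (2 * Rabs R)) _ S (fun k => H0 (2 * Rabs R) k v ltac:(lra) ltac:(lra)) (Hf v) HS).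
  - apply Rle_trans with S; [|lra].
    apply (is_series_Cmod_le _ (M (2 * Rabs R)) _ S (fun k => H1 (2 * Rabs R) k v ltac:(lra) ltac:(lra)) (Hf' v) HS).
  - pose proof (is_series_plus_C _ _ _ _ (Hf (v + h)%C)
      (is_series_plus_C _ _ _ _ (is_series_scal_C (- (1))%C _ _ (Hf v)) (is_series_scal_C (- h)%C _ _ (Hf' v)))) as Hs.
    replace (f (v + h) - f v - h * f' v)%C with (f (v + h) + (- (1) * f v + - h * f' v))%C by ring.
    pose proof (is_series_scal (3 * (Cmod h * Cmod h)) (M (2 * Rabs R)) S HS) as HS'.
    replace (3 * S * (Cmod h * Cmod h)) with (scal (3 * (Cmod h * Cmod h)) S) by (unfold scal; simpl; unfold mult; simpl; ring).
    refine (is_series_Cmod_le _ _ _ _ _ Hs HS'). intros k. simpl.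
    replace (c k * cexp (b k * (v + h)) + (- (1) * (c k * cexp (b k * v)) + - h * (b k * (c k * cexp (b k * v)))))%C
      with (c k * cexp (b k * v) * (cexp (b k * h) - 1 - b k * h))%C.
    2:{ replace (b k * (v + h))%C with (b k * v + b k * h)%C by ring. rewrite cexp_plus. ring. }
    pose proof (cexp_taylor_bound (b k * h)) as Ht. rewrite Cmod_mult in Ht.
    pose proof (Cmod_ge_0 (c k)) as C0. pose proof (Cmod_ge_0 (b k)) as B0. pose proof (Cmod_ge_0 h) as h0.
    assert (He : exp (Rabs (Re (b k * h))) <= exp (Cmod (b k) * Rabs R)).
    { apply exp_le. eapply Rle_trans; [apply re_le_Cmod|]. rewrite Cmod_mult.
      apply Rmult_le_compat_l; lra. }
    pose proof (Hexp k v (Rabs R) ltac:(lra)) as Hv'.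
    specialize (Hle (2 * Rabs R) k ltac:(lra)).
    replace (exp (Cmod (b k) * (2 * Rabs R))) with (exp (Cmod (b k) * Rabs R) * exp (Cmod (b k) * Rabs R)) in Hle
      by (rewrite <- exp_plus; f_equal; ring).
    pose proof (exp_pos (Cmod (b k) * Rabs R)) as E0.
    change (scal (3 * (Cmod h * Cmod h)) (M (2 * Rabs R) k)) with (3 * (Cmod h * Cmod h) * M (2 * Rabs R) k).
    eapply Rle_trans; [apply Cmod_prod_le; [apply Cmod_prod_le; [apply Rle_refl|exact Hv']|exact Ht]|].
    eapply Rle_trans; [|apply Rmult_le_compat_l; [nra|exact Hle]].
    set (e := exp (Cmod (b k) * Rabs R)) in *. set (B := Cmod (b k)) in *. set (A := Cmod (c k)) in *. set (H := Cmod h) in *.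
    set (e' := exp (Rabs (Re (b k * h)))) in *.
    assert (0 <= A * e * (H * H) * (B * B)) by (repeat apply Rmult_le_pos; lra).
    apply Rle_trans with (A * e * (3 * e * (B * H * (B * H)))).
    + apply Rmult_le_compat_l; [nra|]. apply Rmult_le_compat_r; [|lra]. nra.
    + replace (A * e * (3 * e * (B * H * (B * H)))) with (3 * (H * H) * (A * (B * B) * (e * e))) by ring.
      apply Rmult_le_compat_l; [nra|]. apply Rmult_le_compat_r; [nra|]. apply Rmult_le_compat_l; nra.
Qed.

(** The split at [0] copies the two halves of [theta]. Both must converge, so that a reindexing
    merely moves a term across or swaps the halves. *)
Definition is_zseries (f : Z -> C) (l : C) : Prop :=
  exists l1 l2, is_series (fun k => f (Z.of_nat k)) l1 /\
    is_series (fun k => f (- Z.of_nat (S k))%Z) l2 /\ l = (l1 + l2)%C.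

Lemma is_zseries_ext (f g : Z -> C) (l : C) : (forall n, f n = g n) -> is_zseries f l -> is_zseries g l.
Proof. intros H. replace g with f; auto. apply functional_extensionality; auto. Qed.

Lemma is_zseries_scal (c : C) (f : Z -> C) (l : C) :
  is_zseries f l -> is_zseries (fun n => c * f n)%C (c * l)%C.
Proof.
  intros [a [b [Ha [Hb ->]]]]. exists (c * a)%C, (c * b)%C.
  repeat split; [exact (is_series_scal_C c _ _ Ha)|exact (is_series_scal_C c _ _ Hb)|ring].
Qed.

Lemma is_zseries_succ (f : Z -> C) (l : C) :
  is_zseries f l -> is_zseries (fun n => f (n + 1)%Z) l.
Proof.
  intros [a [b [Ha [Hb ->]]]]. exists (a - f 0%Z)%C, (b + f 0%Z)%C. repeat split; [| |ring].
  - apply is_series_incr_1_C in Ha.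
    eapply is_series_ext; [|exact Ha]. intros k. cbv beta. f_equal. lia.
  - apply (is_series_decr_1_C (fun k => f (- Z.of_nat k)%Z)) in Hb.
    eapply is_series_ext; [|exact Hb]. intros k. cbv beta. f_equal. lia.
Qed.

(** The map [n -> -1 - n] swaps the two halves exactly. It is the symmetry that changes the sign of
    [n + 1/2] and makes [theta 1 1] odd. *)
Lemma is_zseries_reflect (f : Z -> C) (l : C) :
  is_zseries f l -> is_zseries (fun n => f (- 1 - n)%Z) l.
Proof.
  intros [a [b [Ha [Hb ->]]]]. exists b, a. repeat split; [| |ring].
  - eapply is_series_ext; [|exact Hb]. intros k. cbv beta. f_equal. lia.
  - eapply is_series_ext; [|exact Ha]. intros k. cbv beta. f_equal. lia.
Qed.

Lemma theta_unique (eps eps' : R) (v tau l : C) :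
  is_zseries (theta_term eps eps' v tau) l -> theta eps eps' v tau = l.
Proof.
  intros [a [b [Ha [Hb ->]]]]. unfold theta.
  f_equal; apply CSeries_unique; auto.
Qed.

Definition half (n : Z) : R := IZR n + 1 / 2.

Lemma theta_term_11 (v tau : C) (n : Z) :
  theta_term 1 1 v tau n =
  (cexp (PI * Ci * (half n * half n * tau + half n)) * cexp (2 * PI * Ci * half n * v))%C.
Proof.
  unfold theta_term. rewrite <- cexp_plus. f_equal. change Defs.Ci with Ci.
  fold (half n). unfold Rdiv. rewrite !RtoC_mult, !RtoC_inv by lra. field.
Qed.

(** The Gaussian [exp (- y p^2)] with [y = PI * Im tau] absorbs both the exponential growth and the
    polynomial, which is at most [(1 + |b|)^2 <= exp (2 |b|)]. Prescribing only [Rabs p] serves the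
    indices of both signs. *)
Lemma theta_half_bound (tau : C) (r : R) : 0 < Im tau -> 0 <= r ->
  exists A, forall (p : R) (k : nat), Rabs p = INR k + 1 / 2 ->
   let c := cexp (PI * Ci * (p * p * tau + p))%C in
   let b := (2 * PI * Ci * p)%C in
   Cmod c * (1 + Cmod b + Cmod b * Cmod b) * exp (Cmod b * r) <= A * exp (-1) ^ k.
Proof.
  intros Ht Hr. pose proof PI_RGT_0 as Hpi.
  set (D := 2 * PI * (r + 2)). set (y := PI * Im tau).
  assert (Hy : 0 < y) by (unfold y; nra).
  (* With [q = Rabs p] the exponent is at most [D q - y q^2]. The constant is the maximum of
     [(D + 1) q - y q^2], which leaves [- q <= - k]. *)
  exists (exp ((D + 1) * (D + 1) / (4 * y))). intros p k Hp c b.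
  pose proof (Rabs_pos p) as Hp0.
  assert (Hpp : p * p = Rabs p * Rabs p) by (rewrite <- Rabs_mult, Rabs_right; auto; nra).
  assert (Hc : Cmod c = exp (- y * (Rabs p * Rabs p))).
  { unfold c. rewrite Cmod_cexp, <- Hpp. f_equal. unfold y. destruct tau; simpl; ring. }
  assert (Hb : Cmod b = 2 * PI * Rabs p).
  { unfold b. rewrite !Cmod_mult, !Cmod_R, Cmod_Ci, (Rabs_right 2), (Rabs_right PI) by lra. ring. }
  assert (Hk : exp (-1) ^ k = exp (- INR k)).
  { clear. induction k as [|k IH]; [simpl; rewrite Ropp_0, exp_0; auto|].
    rewrite S_INR. simpl. rewrite IH, <- exp_plus. f_equal. ring. }
  rewrite Hc, Hb, Hk. set (q := Rabs p) in *.
  assert (0 <= 2 * PI * q) by nra.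
  assert (Hpoly : 1 + 2 * PI * q + 2 * PI * q * (2 * PI * q) <= exp (2 * (2 * PI * q))).
  { set (B := 2 * PI * q) in *. replace (2 * B) with (B + B) by ring. rewrite exp_plus.
    pose proof (exp_ineq1_le B). nra. }
  apply Rle_trans with (exp (- y * (q * q)) * exp (2 * (2 * PI * q)) * exp (2 * PI * q * r)).
  { apply Rmult_le_compat_r; [left; apply exp_pos|]. apply Rmult_le_compat_l; auto. left; apply exp_pos. }
  rewrite <- !exp_plus. apply exp_le.
  replace (- y * (q * q) + 2 * (2 * PI * q) + 2 * PI * q * r) with (- y * (q * q) + D * q) by (unfold D; ring).
  assert (E : (D + 1) * (D + 1) / (4 * y) - (D + 1) * q + y * (q * q) = y * ((q - (D + 1) / (2 * y)) * (q - (D + 1) / (2 * y)))) by (field; lra).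
  assert (0 <= y * ((q - (D + 1) / (2 * y)) * (q - (D + 1) / (2 * y)))) by (apply Rmult_le_pos; [lra|apply Rle_0_sqr]).
  lra.
Qed.

Lemma theta_11_hol (tau : C) : 0 < Im tau -> exists T',
  hol (fun v => theta 1 1 v tau) T' /\
  (forall v, is_zseries (theta_term 1 1 v tau) (theta 1 1 v tau)) /\
  (forall v, is_zseries (fun n => 2 * PI * Ci * half n * theta_term 1 1 v tau n)%C (T' v)).
Proof.
  intros Ht.
  (* Both halves of the series enumerate indices with [Rabs (half n) = k + 1/2], so one argument
     covers them. *)
  assert (Hgen : forall s : nat -> Z, (forall k, Rabs (half (s k)) = INR k + 1 / 2) ->
    exists f f', hol f f' /\ (forall v, is_series (fun k => theta_term 1 1 v tau (s k)) (f v)) /\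
     (forall v, is_series (fun k => 2 * PI * Ci * half (s k) * theta_term 1 1 v tau (s k))%C (f' v))).
  { intros s Hs.
    destruct (hol_series (fun k => cexp (PI * Ci * (half (s k) * half (s k) * tau + half (s k)))%C)
      (fun k => 2 * PI * Ci * half (s k))%C
      (fun r k => Cmod (cexp (PI * Ci * (half (s k) * half (s k) * tau + half (s k)))) *
        (1 + Cmod (2 * PI * Ci * half (s k)) + Cmod (2 * PI * Ci * half (s k)) * Cmod (2 * PI * Ci * half (s k)))
        * exp (Cmod (2 * PI * Ci * half (s k)) * r))) as [f [f' [H1 [H2 H3]]]].
    - intros r Hr. destruct (theta_half_bound tau r Ht Hr) as [A HA].
      apply (@ex_series_le R_AbsRing R_CompleteNormedModule _ (fun k => A * exp (-1) ^ k)).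
      + intros k. specialize (HA (half (s k)) k (Hs k)).
        unfold norm; simpl. unfold abs; simpl. rewrite Rabs_right; auto.
        apply Rle_ge. pose proof (Cmod_ge_0 (2 * PI * Ci * half (s k))).
        repeat apply Rmult_le_pos; auto using Cmod_ge_0; [nra|left; apply exp_pos].
      + apply (ex_series_scal_l (K := R_AbsRing) (V := R_NormedModule)). apply ex_series_geom.
        pose proof (exp_pos (-1)). rewrite Rabs_right by lra.
        rewrite <- exp_0. apply exp_increasing. lra.
    - intros r k Hr. apply Rle_refl.
    - exists f, f'. split; auto. split; intros v.
      + eapply is_series_ext; [|exact (H2 v)]. intros k. simpl. rewrite theta_term_11. reflexivity.
      + eapply is_series_ext; [|exact (H3 v)]. intros k. simpl. rewrite theta_term_11. reflexivity. }
  destruct (Hgen Z.of_nat) as [f [f' [H1 [H2 H3]]]].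
  { intros k. unfold half. rewrite <- INR_IZR_INZ. pose proof (pos_INR k). rewrite Rabs_right; lra. }
  destruct (Hgen (fun k => - Z.of_nat (S k))%Z) as [g [g' [G1 [G2 G3]]]].
  { intros k. unfold half. rewrite opp_IZR, <- INR_IZR_INZ, S_INR. pose proof (pos_INR k). rewrite Rabs_left; lra. }
  assert (Hz : forall v, is_zseries (theta_term 1 1 v tau) (f v + g v)%C).
  { intros v. exists (f v), (g v). auto. }
  exists (fun v => f' v + g' v)%C. split; [|split].
  - eapply hol_ext; [| |exact (hol_plus _ _ _ _ H1 G1)]; intros v; simpl; auto.
    symmetry. apply theta_unique; auto.
  - intros v. rewrite (theta_unique _ _ _ _ _ (Hz v)). auto.
  - intros v. exists (f' v), (g' v). auto.
Qed.

Lemma theta_11_plus_1 (v tau : C) : 0 < Im tau -> theta 1 1 (v + 1) tau = (- theta 1 1 v tau)%C.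
Proof.
  intros Ht. destruct (theta_11_hol tau Ht) as [T' [_ [Hz _]]].
  replace (- theta 1 1 v tau)%C with (- (1) * theta 1 1 v tau)%C by ring.
  apply theta_unique. eapply is_zseries_ext; [|exact (is_zseries_scal _ _ _ (Hz v))].
  intros n. simpl. rewrite !theta_term_11.
  replace (2 * PI * Ci * half n * (v + 1))%C with (2 * PI * Ci * half n * v + 2 * PI * Ci * half n)%C by ring.
  rewrite cexp_plus.
  replace (cexp (2 * PI * Ci * half n)) with (- (1))%C; [ring|].
  rewrite (cexp_eq_mod (2 * PI * Ci * half n) (PI * Ci) n).
  - symmetry. apply cexp_PI.
  - unfold half. rewrite RtoC_plus, RtoC_div by lra. field.
Qed.

(** Completing the square turns the term of index [n] at [v + tau] into the term of index [n + 1] at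
    [v], times a factor free of [n]. *)
Lemma theta_11_plus_tau (v tau : C) : 0 < Im tau ->
  theta 1 1 (v + tau) tau = (- cexp (- (PI * Ci * (tau + 2 * v))) * theta 1 1 v tau)%C.
Proof.
  intros Ht. destruct (theta_11_hol tau Ht) as [T' [_ [Hz _]]].
  apply theta_unique. eapply is_zseries_ext; [|exact (is_zseries_scal _ _ _ (is_zseries_succ _ _ (Hz v)))].
  intros n. simpl. rewrite !theta_term_11.
  assert (E : forall x y : C, (- x * y = cexp (PI * Ci) * (x * y))%C) by (intros; rewrite cexp_PI; ring).
  rewrite E, <- !cexp_plus. apply cexp_eq_mod with 1%Z.
  unfold half. rewrite plus_IZR, !RtoC_plus, RtoC_div by lra. field.
Qed.

Lemma theta_11_odd (v tau : C) : 0 < Im tau -> theta 1 1 (- v) tau = (- theta 1 1 v tau)%C.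
Proof.
  intros Ht. destruct (theta_11_hol tau Ht) as [T' [_ [Hz _]]].
  replace (- theta 1 1 v tau)%C with (- (1) * theta 1 1 v tau)%C by ring.
  apply theta_unique. eapply is_zseries_ext; [|exact (is_zseries_scal _ _ _ (is_zseries_reflect _ _ (Hz v)))].
  intros n. cbv beta. rewrite !theta_term_11.
  rewrite <- cexp_PI, <- !cexp_plus. apply cexp_eq_mod with (- n)%Z.
  unfold half. rewrite minus_IZR, opp_IZR, RtoC_opp, !RtoC_plus, !RtoC_minus, RtoC_div by lra. field.
Qed.

(** * Limits and dominated convergence *)

Definition ctends (u : nat -> C) (l : C) : Prop :=
  forall eps, 0 < eps -> exists N, forall n, (N <= n)%nat -> Cmod (u n - l) < eps.

Lemma ctends_filterlim (u : nat -> C) (l : C) : ctends u l <-> filterlim u eventually (locally l).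
Proof.
  rewrite (filterlim_locally_ball_norm (K := C_AbsRing) (U := C_NormedModule) u l). split.
  - intros H eps. destruct (H eps (cond_pos eps)) as [N HN]. exists N. exact HN.
  - intros H eps Heps. destruct (H (mkposreal eps Heps)) as [N HN]. exists N. exact HN.
Qed.

Lemma ctends_unique (u : nat -> C) (l m : C) : ctends u l -> ctends u m -> l = m.
Proof.
  intros Hl Hm. apply ctends_filterlim in Hl, Hm.
  exact (@filterlim_locally_unique nat C_AbsRing C_NormedModule eventually _ u l m Hl Hm).
Qed.

Lemma ctends_const (c : C) : ctends (fun _ => c) c.
Proof.
  intros eps Heps. exists O. intros n _. replace (c - c)%C with (RtoC 0) by ring. rewrite Cmod_0; auto.
Qed.

Lemma ctends_ext_from (u v : nat -> C) (l : C) (K : nat) :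
  (forall n, (K <= n)%nat -> u n = v n) -> ctends u l -> ctends v l.
Proof.
  intros H Hu eps Heps. destruct (Hu eps Heps) as [N HN]. exists (Nat.max K N).
  intros n Hn. rewrite <- H by lia. apply HN. lia.
Qed.

Lemma ctends_comp (u : nat -> C) (l : C) (phi : nat -> nat) (K : nat) :
  (forall n, (n <= phi n + K)%nat) -> ctends u l -> ctends (fun n => u (phi n)) l.
Proof.
  intros H Hu eps Heps. destruct (Hu eps Heps) as [N HN]. exists (N + K)%nat.
  intros n Hn. apply HN. specialize (H n). lia.
Qed.

Lemma ctends_plus (u v : nat -> C) (l m : C) :
  ctends u l -> ctends v m -> ctends (fun n => u n + v n)%C (l + m)%C.
Proof.
  intros Hu Hv eps Heps.
  destruct (Hu (eps / 2) ltac:(lra)) as [N1 H1]. destruct (Hv (eps / 2) ltac:(lra)) as [N2 H2].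
  exists (Nat.max N1 N2). intros n Hn.
  replace (u n + v n - (l + m))%C with ((u n - l) + (v n - m))%C by ring.
  eapply Rle_lt_trans; [apply Cmod_triangle|].
  specialize (H1 n ltac:(lia)). specialize (H2 n ltac:(lia)). lra.
Qed.

Lemma ctends_mult (u v : nat -> C) (l m : C) :
  ctends u l -> ctends v m -> ctends (fun n => u n * v n)%C (l * m)%C.
Proof.
  intros Hu Hv eps Heps.
  pose proof (Cmod_ge_0 l) as L0. pose proof (Cmod_ge_0 m) as M0.
  set (B := Cmod l + Cmod m + 1). assert (0 < B) by (unfold B; lra).
  set (d := Rmin 1 (eps / (2 * B))).
  assert (Hd : 0 < d) by (apply Rmin_pos; [lra|apply Rdiv_lt_0_compat; lra]).
  assert (Hd1 : d <= 1) by apply Rmin_l.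
  assert (Hd2 : d * B <= eps / 2).
  { apply Rle_trans with (eps / (2 * B) * B); [apply Rmult_le_compat_r; [lra|apply Rmin_r]|]. right; field; lra. }
  destruct (Hu d Hd) as [N1 H1]. destruct (Hv d Hd) as [N2 H2].
  exists (Nat.max N1 N2). intros n Hn.
  specialize (H1 n ltac:(lia)). specialize (H2 n ltac:(lia)).
  replace (u n * v n - l * m)%C with ((u n - l) * (v n - m) + (l * (v n - m) + (u n - l) * m))%C by ring.
  apply Rle_lt_trans with (d * d + (Cmod l * d + d * Cmod m)).
  - repeat apply Cmod_sum_le; apply Cmod_prod_le; lra.
  - apply Rle_lt_trans with (d * B); [unfold B; nra|lra].
Qed.

Lemma ctends_Cmod_ge (u : nat -> C) (l : C) (c : R) :
  (forall n, c <= Cmod (u n)) -> ctends u l -> c <= Cmod l.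
Proof.
  intros H Hu. apply Rnot_lt_le. intros Hlt.
  destruct (Hu (c - Cmod l) ltac:(lra)) as [N HN]. specialize (HN N (le_n _)). specialize (H N).
  pose proof (Cmod_triangle (u N - l) l) as Ht. replace (u N - l + l)%C with (u N) in Ht by ring. lra.
Qed.

Lemma ctends_inv (u : nat -> C) (l : C) (c : R) : 0 < c ->
  (forall n, c <= Cmod (u n)) -> ctends u l -> ctends (fun n => / u n)%C (/ l)%C.
Proof.
  intros Hc H Hu eps Heps.
  pose proof (ctends_Cmod_ge u l c H Hu) as Hl.
  assert (Hl0 : l <> 0%C) by (apply Cmod_gt_0; lra).
  destruct (Hu (eps * (c * c)) ltac:(repeat apply Rmult_lt_0_compat; auto)) as [N HN].
  exists N. intros n Hn. specialize (HN n Hn). specialize (H n).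
  assert (Hn0 : u n <> 0%C) by (apply Cmod_gt_0; lra).
  assert (E : (u n - l)%C = (- ((/ u n - / l) * (u n * l)))%C) by (field; auto).
  rewrite E, Cmod_opp, !Cmod_mult in HN.
  apply Rmult_lt_reg_r with (c * c); [nra|].
  eapply Rle_lt_trans; [|exact HN]. apply Rmult_le_compat_l; [apply Cmod_ge_0|].
  apply Rmult_le_compat; lra.
Qed.

(** Index [K] itself is excluded, one term fewer than in [sum_n], so that empty sums exist and the
    tail starts exactly at [K]. *)
Fixpoint psum (a : nat -> C) (K : nat) : C :=
  match K with O => 0%C | S k => (psum a k + a k)%C end.

Lemma psum_sum_n (a : nat -> C) (n : nat) : psum a (S n) = sum_n a n.
Proof.
  induction n as [|n IH].
  - rewrite sum_O. simpl. ring.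
  - rewrite sum_Sn, <- IH. reflexivity.
Qed.

Lemma is_series_psum (a : nat -> C) (l : C) : is_series a l <-> ctends (psum a) l.
Proof.
  unfold is_series. rewrite <- ctends_filterlim. split; intros H.
  - intros eps Heps. destruct (H eps Heps) as [N HN]. exists (S N).
    intros [|n] Hn; [lia|]. rewrite psum_sum_n. apply HN. lia.
  - intros eps Heps. destruct (H eps Heps) as [N HN]. exists N.
    intros n Hn. rewrite <- psum_sum_n. apply HN. lia.
Qed.

Lemma is_series_incr_C (a : nat -> C) (l : C) (K : nat) :
  is_series a l -> is_series (fun n => a (K + n)%nat) (l - psum a K)%C.
Proof.
  intros H. induction K as [|K IH].
  - simpl. replace (l - 0)%C with l by ring. exact H.
  - apply is_series_incr_1_C in IH. rewrite Nat.add_0_r in IH.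
    simpl psum. replace (l - (psum a K + a K))%C with (l - psum a K - a K)%C by ring.
    eapply is_series_ext; [|exact IH]. intros n. cbv beta. f_equal. lia.
Qed.

Lemma is_series_finite (a : nat -> C) (K : nat) :
  (forall n, (K <= n)%nat -> a n = 0%C) -> is_series a (psum a K).
Proof.
  intros H. apply is_series_psum.
  apply ctends_ext_from with (fun _ => psum a K) K; [|apply ctends_const].
  intros n Hn. induction Hn as [|n Hn IH]; auto. simpl. rewrite <- IH, H by auto. ring.
Qed.

Lemma psum_RtoC (b : nat -> R) (n : nat) : psum (fun n => RtoC (b n)) (S n) = RtoC (sum_n b n).
Proof.
  induction n as [|n IH]; [simpl; rewrite sum_O; ring|].
  rewrite sum_Sn. change (psum (fun n => RtoC (b n)) (S (S n)))
    with (psum (fun n => RtoC (b n)) (S n) + b (S n))%C.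
  rewrite IH. unfold plus; simpl. rewrite RtoC_plus. auto.
Qed.

(** Dominated convergence for series: cut at an index where the tail of [b] is below [eps / 4]. The
    two tails then cost [eps / 2] together, and the finite head converges term by term. *)
Lemma tannery (a : nat -> nat -> C) (b : nat -> R) (l S : nat -> C) (L : C) :
  ex_series b -> (forall N n, Cmod (a N n) <= b n) -> (forall n, Cmod (l n) <= b n) ->
  (forall n, ctends (fun N => a N n) (l n)) ->
  (forall N, is_series (a N) (S N)) -> is_series l L -> ctends S L.
Proof.
  intros [B0 HB] Ha Hl Hlim HS HL eps Heps. set (B := B0 : R). change B0 with B in HB. clearbody B. clear B0.
  assert (HB' : is_series (fun n => RtoC (b n)) (RtoC B)).
  { apply is_series_psum. intros e He.
    change (is_lim_seq (sum_n b) B) in HB. apply is_lim_seq_spec in HB. destruct (HB (mkposreal e He)) as [N HN]. exists (Datatypes.S N).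
    intros [|n] Hn; [lia|]. specialize (HN n ltac:(lia)). simpl in HN.
    rewrite psum_RtoC, <- RtoC_minus, Cmod_R. exact HN. }
  pose proof (proj1 (is_series_psum _ _) HB') as HBt.
  destruct (HBt (eps / 4) ltac:(lra)) as [K HK]. specialize (HK K (le_n _)).
  assert (Hfin : forall K', ctends (fun N => psum (a N) K' - psum l K')%C 0%C).
  { induction K' as [|K' IH].
    - simpl. apply ctends_ext_from with (fun _ => 0%C) O; [|apply ctends_const]. intros; ring.
    - pose proof (ctends_plus _ _ _ _ IH (ctends_plus _ _ _ _ (Hlim K') (ctends_const (- l K')%C))) as H.
      replace (0 + (l K' + - l K'))%C with (RtoC 0) in H by ring.
      eapply (ctends_ext_from _ _ _ O); [|exact H]. intros n _. simpl. ring. }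
  destruct (Hfin K (eps / 4) ltac:(lra)) as [N0 HN0]. exists N0. intros N HN. specialize (HN0 N HN).
  pose proof (is_series_plus_C _ _ _ _ (is_series_incr_C _ _ K (HS N))
     (is_series_scal_C (- (1))%C _ _ (is_series_incr_C _ _ K HL))) as Ht.
  pose proof (is_series_incr_C _ _ K HB') as HBK.
  assert (Htail : Cmod (S N - psum (a N) K + - (1) * (L - psum l K)) <= 2 * Re (RtoC B - psum (fun n => RtoC (b n)) K)).
  { refine (is_series_Cmod_le _ (fun n => 2 * b (K + n)%nat) _ _ _ Ht _).
    - intros n. replace (2 * b (K + n)%nat) with (b (K + n)%nat + b (K + n)%nat) by ring.
      apply Cmod_sum_le; auto. rewrite Cmod_mult, Cmod_m1, Rmult_1_l. auto.
    - apply (is_series_scal (K := R_AbsRing) (V := R_NormedModule) 2 (fun n => b (K + n)%nat)).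
      apply is_series_psum in HBK. change (is_lim_seq (sum_n (fun n => b (K + n)%nat)) (Re (RtoC B - psum (fun n => RtoC (b n)) K))). apply is_lim_seq_spec. intros e.
      destruct (HBK e (cond_pos e)) as [N1 HN1]. exists N1. intros n Hn.
      specialize (HN1 (Datatypes.S n) ltac:(lia)). eapply Rle_lt_trans; [|exact HN1].
      eapply Rle_trans; [|apply re_le_Cmod]. right. f_equal.
      rewrite (psum_RtoC (fun n => b (K + n)%nat)). reflexivity. }
  pose proof (re_le_Cmod (B - psum (fun n => RtoC (b n)) K)%C) as Hre.
  replace (Cmod (psum (fun n => RtoC (b n)) K - B)) with (Cmod (B - psum (fun n => RtoC (b n)) K)) in HK
    by (rewrite <- Cmod_opp; f_equal; ring).
  pose proof (Rle_abs (Re (B - psum (fun n => RtoC (b n)) K))).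
  replace (S N - L)%C with ((S N - psum (a N) K + - (1) * (L - psum l K)) + (psum (a N) K - psum l K - 0))%C by ring.
  eapply Rle_lt_trans; [apply Cmod_triangle|]. lra.
Qed.

(** * Jacobi's identity for the cube of the Euler product *)

(** This is [(-1)^n q^(n(n+1)/2)]; Jacobi's series is the sum of [(2 n + 1) jac q n]. *)
Fixpoint jac (q : C) (n : nat) : C :=
  match n with O => 1%C | S k => (- q ^ S k * jac q k)%C end.

(* [jac_fin q N n] is (-1)^n q^(n(n+1)/2) times the q-binomial [2N+1 choose N-n]; the recursion multiplies the generating Laurent polynomial by (1 - z q^(N+1)) (1 - q^(N+1)/z), folded along the symmetry n -> -1-n. *)
Fixpoint jac_fin (q : C) (N n : nat) : C :=
  match N with
  | O => match n with O => 1%C | S _ => 0%C end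
  | S M => ((1 + q ^ S M * q ^ S M) * jac_fin q M n
      - q ^ S M * (match n with O => - jac_fin q M 0 | S k => jac_fin q M k end + jac_fin q M (S n)))%C
  end.

Definition qpoch (q : C) (m : nat) : C := partial_prod (fun n => 1 - q ^ n)%C m.

Lemma qpoch_S (q : C) (m : nat) : qpoch q (S m) = (qpoch q m * (1 - q ^ S m))%C.
Proof. reflexivity. Qed.

Lemma jac_fin_support (q : C) (N n : nat) : (N < n)%nat -> jac_fin q N n = 0%C.
Proof.
  revert n. induction N as [|N IH]; intros n Hn; destruct n as [|n]; try lia; auto.
  change (jac_fin q (S N) (S n)) with ((1 + q ^ S N * q ^ S N) * jac_fin q N (S n)
      - q ^ S N * (jac_fin q N n + jac_fin q N (S (S n))))%C.
  rewrite !IH by lia. ring.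
Qed.

(** By the antisymmetry under [n -> -1 - n], the weights [2 n + 1] compute the derivative at [z = 1]
    of the generating Laurent polynomial, which vanishes there. Multiplying it by
    [(1 - z Q) (1 - Q / z)], with [Q = q^(N+1)], therefore multiplies the full sum by [(1 - Q)^2].
    The last term is the boundary effect of the cut at [L]. *)
Lemma jac_fin_sum_step (q : C) (N L : nat) :
  psum (fun n => (2 * INR n + 1) * jac_fin q (S N) n)%C (S L) =
  ((1 - q ^ S N) * (1 - q ^ S N) * psum (fun n => (2 * INR n + 1) * jac_fin q N n) (S L)
   - q ^ S N * ((2 * INR L + 1) * jac_fin q N (S L) - (2 * INR L + 3) * jac_fin q N L))%C.
Proof.
  induction L as [|L IH].
  - change (psum (fun n => (2 * INR n + 1) * jac_fin q (S N) n)%C 1) with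
      (0 + (2 * 0 + 1) * ((1 + q ^ S N * q ^ S N) * jac_fin q N 0
      - q ^ S N * (- jac_fin q N 0 + jac_fin q N 1)))%C.
    change (psum (fun n => (2 * INR n + 1) * jac_fin q N n)%C 1) with
      (0 + (2 * 0 + 1) * jac_fin q N 0)%C. change (INR 0) with 0. ring.
  - change (psum (fun n => (2 * INR n + 1) * jac_fin q (S N) n)%C (S (S L))) with
      (psum (fun n => (2 * INR n + 1) * jac_fin q (S N) n) (S L) +
      (2 * INR (S L) + 1) * ((1 + q ^ S N * q ^ S N) * jac_fin q N (S L)
      - q ^ S N * (jac_fin q N L + jac_fin q N (S (S L)))))%C.
    change (psum (fun n => (2 * INR n + 1) * jac_fin q N n)%C (S (S L))) with
      (psum (fun n => (2 * INR n + 1) * jac_fin q N n) (S L) + (2 * INR (S L) + 1) * jac_fin q N (S L))%C.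
    rewrite IH, S_INR, RtoC_plus. ring.
Qed.

Lemma jac_fin_sum (q : C) (N L : nat) : (N < L)%nat ->
  psum (fun n => (2 * INR n + 1) * jac_fin q N n)%C L = (qpoch q N * qpoch q N)%C.
Proof.
  revert L. induction N as [|N IH]; intros L HL.
  - destruct L as [|L]; [lia|]. induction L as [|L IHL].
    + unfold qpoch. simpl. ring.
    + change (psum (fun n => (2 * INR n + 1) * jac_fin q 0 n)%C (S (S L))) with
      (psum (fun n => (2 * INR n + 1) * jac_fin q 0 n) (S L) + (2 * INR (S L) + 1) * 0)%C.
      rewrite IHL by lia. ring.
  - destruct L as [|L]; [lia|]. rewrite jac_fin_sum_step, IH, qpoch_S by lia.
    rewrite !jac_fin_support by lia. ring.
Qed.

(** * The Euler product inside the unit disk and the limit of the finite identity *)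

Section Disk.
Variables (q : C) (s : R).
Hypothesis Hq0 : q <> 0%C.
Hypothesis Hs : 0 < s < 1.
Hypothesis Hqs : Cmod q <= s * s.

Lemma Cmod_q_pow (n : nat) : Cmod (q ^ n) <= s ^ n.
Proof.
  rewrite Cmod_pow. apply pow_incr. split; [apply Cmod_ge_0|nra].
Qed.

Lemma Cmod_one_minus_ge (n : nat) : 1 - s ^ n <= Cmod (1 - q ^ n)%C.
Proof.
  pose proof (Cmod_triangle (1 - q ^ n) (q ^ n)) as H.
  replace (1 - q ^ n + q ^ n)%C with (RtoC 1) in H by ring. rewrite Cmod_1 in H.
  pose proof (Cmod_q_pow n). lra.
Qed.

Lemma pow_s_bounds (n : nat) : 0 < s ^ S n <= s /\ s ^ S n < 1.
Proof.
  assert (0 < s ^ n <= 1).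
  { induction n as [|n IH]; simpl; [lra|]. nra. }
  simpl. nra.
Qed.

Lemma one_minus_neq_0 (n : nat) : (1 - q ^ S n)%C <> 0%C.
Proof.
  apply Cmod_gt_0. pose proof (Cmod_one_minus_ge (S n)). pose proof (pow_s_bounds n). lra.
Qed.

Lemma qpoch_neq_0 (m : nat) : qpoch q m <> 0%C.
Proof.
  induction m as [|m IH].
  - simpl. apply RtoC_neq_0. lra.
  - rewrite qpoch_S. apply Cmult_neq_0; auto using one_minus_neq_0.
Qed.

(** The reciprocal of the q-factorial of [N - n], read as [0] for [n > N], where truncated
    subtraction would give [1]. With this convention the relations between neighbours survive at the
    edge of the support. *)
Definition rinv (N n : nat) : C := if (n <=? N)%nat then (/ qpoch q (N - n))%C else 0%C.

Lemma rinv_same (N n : nat) : (n <= S N)%nat -> rinv N n = ((1 - q ^ (S N - n)) * rinv (S N) n)%C.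
Proof.
  intros H. unfold rinv. destruct (Nat.leb_spec n N), (Nat.leb_spec n (S N)); try lia.
  - replace (S N - n)%nat with (S (N - n)) by lia. rewrite qpoch_S.
    field. split; [apply one_minus_neq_0|apply qpoch_neq_0].
  - replace (S N - n)%nat with 0%nat by lia. simpl. ring.
Qed.

Lemma rinv_succ (N n : nat) : (n <= N)%nat -> rinv N (S n) = ((1 - q ^ (N - n)) * rinv N n)%C.
Proof.
  intros H. unfold rinv. destruct (Nat.leb_spec n N), (Nat.leb_spec (S n) N); try lia.
  - replace (N - n)%nat with (S (N - S n)) by lia. rewrite qpoch_S.
    field. split; [apply one_minus_neq_0|apply qpoch_neq_0].
  - replace (N - n)%nat with 0%nat by lia. simpl. ring.
Qed.

Lemma inv_qpoch (m : nat) : (/ qpoch q m = (1 - q ^ S m) * / qpoch q (S m))%C.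
Proof. rewrite qpoch_S. field. split; [apply one_minus_neq_0|apply qpoch_neq_0]. Qed.

(** The q-Pascal recursion is checked directly: all reciprocals are brought to [rinv (S N) n] and
    the q-factorial of [S N + n + 1], and a polynomial identity in powers of [q] remains. The closed
    form supplies the uniform bound and the limit in [N]. *)
Lemma jac_fin_closed (N n : nat) :
  jac_fin q N n = (jac q n * qpoch q (2 * N + 1) * rinv N n * / qpoch q (N + n + 1))%C.
Proof.
  revert n. induction N as [|N IH]; intros n.
  - destruct n as [|n].
    + unfold rinv, qpoch; simpl. field. replace (1 - q * 1)%C with (1 - q ^ 1)%C by (simpl; ring).
      intros E. apply (one_minus_neq_0 0). rewrite <- E. simpl. ring.
    + unfold rinv; simpl. ring.
  - destruct (le_lt_dec n (S N)) as [Hn|Hn].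
    2:{ rewrite jac_fin_support by lia. unfold rinv. destruct (Nat.leb_spec n (S N)); try lia. ring. }
    assert (HD : qpoch q (2 * S N + 1) = (qpoch q (2 * N + 1) * ((1 - q ^ (2 * N + 2)) * (1 - q ^ (2 * N + 3))))%C).
    { replace (2 * S N + 1)%nat with (S (S (2 * N + 1))) by lia. rewrite !qpoch_S.
      replace (S (S (2 * N + 1))) with (2 * N + 3)%nat by lia.
      replace (S (2 * N + 1)) with (2 * N + 2)%nat by lia. ring. }
    assert (Hsucc : rinv N (S n) = ((1 - q ^ (N - n)) * (1 - q ^ (S N - n)) * rinv (S N) n)%C).
    { destruct (le_lt_dec n N) as [H|H].
      - rewrite rinv_succ, rinv_same by lia. ring.
      - replace (S N - n)%nat with 0%nat by lia. unfold rinv.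
        destruct (Nat.leb_spec (S n) N); try lia. simpl. ring. }
    (* At [n = S N] truncated subtraction breaks the first relation; there the power is [1], and the
       factor [1 - q ^ (S N - n)] removes the affected terms. *)
    assert (Hy : (q ^ (S N - n) = q * q ^ (N - n) \/ q ^ (S N - n) = 1)%C).
    { destruct (le_lt_dec n N) as [H|H].
      - left. replace (S N - n)%nat with (S (N - n)) by lia. reflexivity.
      - right. replace (S N - n)%nat with 0%nat by lia. reflexivity. }
    assert (HQ : (q ^ S N = q ^ n * q ^ (S N - n))%C).
    { rewrite <- Cpow_add_r. f_equal. lia. }
    assert (HI0 : (/ qpoch q (N + n + 1) = (1 - q ^ S N * q * q ^ n) * / qpoch q (S N + n + 1))%C).
    { rewrite inv_qpoch. replace (S (N + n + 1)) with (S N + n + 1)%nat by lia. f_equal.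
      replace (S N + n + 1)%nat with (S N + (1 + n))%nat by lia. rewrite !Cpow_add_r. simpl. ring. }
    assert (E2 : (q ^ (2 * N + 2) = q ^ S N * q ^ S N)%C).
    { rewrite <- Cpow_add_r. f_equal. lia. }
    assert (E3 : (q ^ (2 * N + 3) = q * (q ^ S N * q ^ S N))%C).
    { rewrite <- Cpow_add_r. change (q ^ (2 * N + 3) = q ^ (S (S N + S N)))%C. f_equal. lia. }
    rewrite HD, E2, E3.
    destruct n as [|n].
    + change (jac_fin q (S N) 0) with ((1 + q ^ S N * q ^ S N) * jac_fin q N 0
      - q ^ S N * (- jac_fin q N 0 + jac_fin q N 1))%C.
      rewrite !IH, Hsucc, (rinv_same N 0) by lia. rewrite HI0.
      replace (N + 1 + 1)%nat with (S N + 0 + 1)%nat by lia.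
      rewrite HQ.
      change (jac q 1) with (- (q * 1) * 1)%C. change (jac q 0) with (RtoC 1). change (q ^ 0)%C with (RtoC 1).
      set (y := (q ^ (S N - 0))%C) in *. set (y' := (q ^ (N - 0))%C) in *.
      destruct Hy as [Hy|Hy]; rewrite Hy; ring.
    + change (jac_fin q (S N) (S n)) with ((1 + q ^ S N * q ^ S N) * jac_fin q N (S n)
      - q ^ S N * (jac_fin q N n + jac_fin q N (S (S n))))%C.
      assert (HI1 : (/ qpoch q (N + n + 1) = (1 - q ^ S N * q ^ S n) * / qpoch q (N + S n + 1))%C).
      { rewrite inv_qpoch. replace (S (N + n + 1)) with (N + S n + 1)%nat by lia. f_equal.
        replace (N + S n + 1)%nat with (S N + S n)%nat by lia. rewrite !Cpow_add_r. ring. }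
      assert (Hr : rinv N n = rinv (S N) (S n)) by reflexivity.
      rewrite !IH, Hsucc, Hr, (rinv_same N (S n)) by lia. rewrite HI1, HI0.
      replace (N + S (S n) + 1)%nat with (S N + S n + 1)%nat by lia.
      rewrite HQ.
      change (jac q (S (S n))) with (- (q * q ^ S n) * (- q ^ S n * jac q n))%C.
      change (jac q (S n)) with (- q ^ S n * jac q n)%C.
      set (y := (q ^ (S N - S n))%C) in *. set (y' := (q ^ (N - S n))%C) in *.
      set (x := (q ^ S n)%C) in *. set (j := jac q n).
      destruct Hy as [Hy|Hy]; rewrite Hy; ring.
Qed.

(** One constant for the products and their inverses: [1 - x >= exp (- x / (1 - s))] for
    [0 < x <= s], and the sum of all [x = s^k] is at most [1 / (1 - s)]. *)
Definition qbound : R := exp (/ (1 - s) * / (1 - s)).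

Lemma pow_s_le_1 (n : nat) : 0 <= s ^ n <= 1.
Proof. induction n as [|n IH]; simpl; [lra|]. nra. Qed.

Lemma qbound_ge_1 : 1 <= qbound.
Proof.
  unfold qbound. assert (0 < / (1 - s)) by (apply Rinv_0_lt_compat; lra).
  rewrite <- exp_0 at 1. apply exp_le. nra.
Qed.

Lemma Cmod_qpoch_le (m : nat) : Cmod (qpoch q m) <= qbound.
Proof.
  assert (H : Cmod (qpoch q m) <= exp (s * (1 - s ^ m) / (1 - s))).
  { induction m as [|m IH].
    - unfold qpoch; simpl. rewrite Cmod_1. replace (s * (1 - 1) / (1 - s)) with 0 by (field; lra). rewrite exp_0; lra.
    - rewrite qpoch_S.
      replace (s * (1 - s ^ S m) / (1 - s)) with (s * (1 - s ^ m) / (1 - s) + s ^ S m) by (simpl; field; lra).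
      rewrite exp_plus. apply Cmod_prod_le; auto.
      apply Rle_trans with (1 + s ^ S m).
      + apply Cmod_sum_le; [rewrite Cmod_1; lra|rewrite Cmod_opp; apply Cmod_q_pow].
      + apply exp_ineq1_le. }
  eapply Rle_trans; [exact H|]. apply exp_le. pose proof (pow_s_le_1 m).
  assert (0 < / (1 - s)) by (apply Rinv_0_lt_compat; lra).
  assert (1 <= / (1 - s)) by (rewrite <- Rinv_1; apply Rinv_le_contravar; lra).
  assert (s * (1 - s ^ m) <= 1 * 1) by (apply Rmult_le_compat; lra).
  unfold Rdiv. apply Rmult_le_compat_r; lra.
Qed.

Lemma Cmod_qpoch_ge (m : nat) : / qbound <= Cmod (qpoch q m).
Proof.
  assert (Hi : 0 < / (1 - s)) by (apply Rinv_0_lt_compat; lra).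
  assert (Hi2 : (1 - s) * / (1 - s) = 1) by (field; lra).
  assert (H : exp (- (s * (1 - s ^ m) / (1 - s) * / (1 - s))) <= Cmod (qpoch q m)).
  { induction m as [|m IH].
    - unfold qpoch; simpl. rewrite Cmod_1.
      replace (- (s * (1 - 1) / (1 - s) * / (1 - s))) with 0 by (field; lra). rewrite exp_0; lra.
    - rewrite qpoch_S, Cmod_mult. set (x := s ^ S m).
      replace (- (s * (1 - x) / (1 - s) * / (1 - s)))
        with (- (s * (1 - s ^ m) / (1 - s) * / (1 - s)) + - (x * / (1 - s))) by (unfold x; simpl; field; lra).
      rewrite exp_plus. apply Rmult_le_compat; try (left; apply exp_pos); auto.
      eapply Rle_trans; [|apply Cmod_one_minus_ge]. fold x.
      pose proof (pow_s_bounds m) as Hx. fold x in Hx.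
      pose proof (exp_ineq1_le (x * / (1 - s))) as He.
      rewrite exp_Ropp.
      apply Rmult_le_reg_l with (exp (x * / (1 - s))); [apply exp_pos|].
      rewrite Rinv_r by (pose proof (exp_pos (x * / (1 - s))); lra).
      (* Expanded, this needs [(1 - x) / (1 - s) >= 1], which is [x <= s]. *)
      apply Rle_trans with ((1 + x * / (1 - s)) * (1 - x)); [|apply Rmult_le_compat_r; lra].
      set (i := / (1 - s)) in *.
      assert (1 = (1 - s) * i) by lra.
      replace ((1 + x * i) * (1 - x)) with (1 + x * (i - (1 + x * i))) by ring.
      assert (0 <= i - (1 + x * i)) by nra. nra. }
  eapply Rle_trans; [|exact H]. unfold qbound. rewrite <- exp_Ropp. apply exp_le.
  pose proof (pow_s_le_1 m). apply Ropp_le_contravar. unfold Rdiv.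
  assert (s * (1 - s ^ m) <= 1 * 1) by (apply Rmult_le_compat; lra).
  apply Rmult_le_compat_r; [lra|]. rewrite <- (Rmult_1_l (/ (1 - s))) at 2.
  apply Rmult_le_compat_r; lra.
Qed.

Lemma qbound_inv_pos : 0 < / qbound.
Proof. apply Rinv_0_lt_compat. pose proof qbound_ge_1. lra. Qed.

Lemma Cmod_inv_le (z : C) : / qbound <= Cmod z -> Cmod (/ z)%C <= qbound.
Proof.
  intros H. pose proof qbound_inv_pos.
  rewrite Cmod_inv by (apply Cmod_gt_0; lra).
  rewrite <- (Rinv_inv qbound). apply Rinv_le_contravar; auto.
Qed.

Lemma ex_series_geom_s (A : R) : ex_series (fun n => A * s ^ n).
Proof.
  apply (ex_series_scal_l (K := R_AbsRing) (V := R_NormedModule)). apply ex_series_geom.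
  rewrite Rabs_right; lra.
Qed.

(** The successive differences [- q^(k+1) * qpoch q k] are geometrically small, so the product
    converges as a telescoping series. *)
Lemma qpoch_converges : exists P, ctends (qpoch q) P.
Proof.
  assert (H : is_series (fun k => qpoch q (S k) - qpoch q k)%C (CSeries (fun k => qpoch q (S k) - qpoch q k)%C)).
  { apply ex_series_Cmod_le with (fun k => qbound * s ^ k); [|apply ex_series_geom_s].
    intros k. rewrite qpoch_S.
    replace (qpoch q k * (1 - q ^ S k) - qpoch q k)%C with (qpoch q k * - q ^ S k)%C by ring.
    apply Cmod_prod_le; [apply Cmod_qpoch_le|]. rewrite Cmod_opp.
    eapply Rle_trans; [apply Cmod_q_pow|]. pose proof (pow_s_le_1 k). simpl. nra. }
  apply is_series_psum in H.
  eexists. eapply (ctends_ext_from _ _ _ O); [|exact (ctends_plus _ _ _ _ H (ctends_const 1%C))].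
  intros n _. cbv beta. induction n as [|n IH]; [unfold qpoch; simpl; ring|].
  change (psum (fun k => qpoch q (S k) - qpoch q k)%C (S n)) with
    (psum (fun k => qpoch q (S k) - qpoch q k) n + (qpoch q (S n) - qpoch q n))%C.
  set (S0 := psum (fun k => qpoch q (S k) - qpoch q k)%C n) in *.
  replace (S0 + (qpoch q (S n) - qpoch q n) + 1)%C with ((S0 + 1) + (qpoch q (S n) - qpoch q n))%C by ring.
  rewrite IH. ring.
Qed.

Lemma Cmod_jac_le (n : nat) : Cmod (jac q n) <= s ^ n * s ^ n.
Proof.
  induction n as [|n IH]; [simpl; rewrite Cmod_1; lra|].
  change (jac q (S n)) with (- (q * q ^ n) * jac q n)%C.
  rewrite Cmod_mult, Cmod_opp, Cmod_mult.
  pose proof (Cmod_q_pow n). pose proof (pow_s_le_1 n). pose proof (Cmod_ge_0 q). pose proof (Cmod_ge_0 (q ^ n)%C).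
  replace (s ^ S n * s ^ S n) with ((s * s * 1) * (s ^ n * s ^ n)) by (simpl; ring).
  apply Rmult_le_compat; auto using Cmod_ge_0; [nra|]. apply Rmult_le_compat; lra.
Qed.

(** A Bernoulli-type inequality. The assumption [|q| <= s * s] provides two factors [s ^ n] in the
    bound for [jac]: one is spent here on [2 n + 1], the other remains as geometric majorant. *)
Lemma odd_pow_bound (n : nat) : (2 * INR n + 1) * s ^ n <= 1 + 2 * / (1 - s).
Proof.
  assert (H : s ^ n * (1 + INR n * (1 - s)) <= 1).
  { induction n as [|n IH]; [simpl; lra|]. rewrite S_INR. eapply Rle_trans; [|exact IH].
    pose proof (pow_s_le_1 n). pose proof (pos_INR n). simpl.
    replace (s * s ^ n * (1 + (INR n + 1) * (1 - s))) with (s ^ n * (s * (1 + (INR n + 1) * (1 - s)))) by ring.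
    apply Rmult_le_compat_l; [lra|].
    assert (0 <= (1 - s) * (1 - s) * (1 + INR n)) by (repeat apply Rmult_le_pos; lra). nra. }
  pose proof (pow_s_le_1 n).
  assert (s ^ n * INR n <= / (1 - s)); [|lra].
  apply Rmult_le_reg_r with (1 - s); [lra|]. rewrite Rinv_l by lra. lra.
Qed.

(** The finite sums equal [qpoch q N] squared, and by the closed form their terms tend to
    [(2 n + 1) jac q n / P]. Tannery's theorem gives [P^2] for the sum of these limits; multiply by
    [P]. *)
Lemma jacobi_identity (P : C) : ctends (qpoch q) P ->
  is_series (fun n => (2 * INR n + 1) * jac q n)%C (P * P * P)%C.
Proof.
  intros HP. pose proof qbound_ge_1 as HM. pose proof qbound_inv_pos as HM'.
  assert (HP0 : / qbound <= Cmod P) by (apply (ctends_Cmod_ge _ _ _ Cmod_qpoch_ge HP)).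
  assert (P <> 0%C) by (apply Cmod_gt_0; lra).
  set (c := 1 + 2 * / (1 - s)).
  assert (Hodd : forall n, Cmod ((2 * INR n + 1) * jac q n) <= c * s ^ n).
  { intros n. rewrite Cmod_mult, <- RtoC_mult, <- RtoC_plus, Cmod_R.
    pose proof (pos_INR n). rewrite Rabs_right by lra.
    pose proof (odd_pow_bound n). pose proof (Cmod_jac_le n). pose proof (pow_s_le_1 n).
    apply Rle_trans with ((2 * INR n + 1) * (s ^ n * s ^ n)); [apply Rmult_le_compat_l; lra|].
    rewrite <- Rmult_assoc. apply Rmult_le_compat_r; unfold c; lra. }
  assert (Hc : 0 < c) by (unfold c; assert (0 < / (1 - s)) by (apply Rinv_0_lt_compat; lra); lra).
  set (b := fun n => c * (qbound * qbound * qbound) * s ^ n).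
  set (l := fun n => ((2 * INR n + 1) * jac q n * / P)%C).
  assert (Hlb : forall n, Cmod (l n) <= b n).
  { intros n. unfold l, b. pose proof (pow_s_le_1 n).
    eapply Rle_trans; [apply Cmod_prod_le; [apply Hodd|apply Cmod_inv_le; exact HP0]|].
    assert (HM1 : 1 * 1 <= qbound * qbound) by (apply Rmult_le_compat; lra).
    assert (HM2 : 1 * qbound <= qbound * qbound * qbound) by (apply Rmult_le_compat_r; lra).
    replace (c * (qbound * qbound * qbound) * s ^ n) with (c * s ^ n * (qbound * qbound * qbound)) by ring.
    apply Rmult_le_compat_l; [|lra]. apply Rmult_le_pos; lra. }
  assert (Hb : ex_series b) by (apply ex_series_geom_s).
  pose proof (ex_series_Cmod_le l b Hlb Hb) as HL.
  assert (E : CSeries l = (P * P)%C).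
  { apply (ctends_unique (fun N => qpoch q N * qpoch q N)%C); [|apply ctends_mult; auto].
    apply (tannery (fun N n => (2 * INR n + 1) * jac_fin q N n)%C b l); auto.
    - intros N n. rewrite jac_fin_closed.
      replace ((2 * INR n + 1) * (jac q n * qpoch q (2 * N + 1) * rinv N n * / qpoch q (N + n + 1)))%C
        with ((2 * INR n + 1) * jac q n * (qpoch q (2 * N + 1) * rinv N n * / qpoch q (N + n + 1)))%C by ring.
      unfold b. replace (c * (qbound * qbound * qbound) * s ^ n) with (c * s ^ n * (qbound * qbound * qbound)) by ring.
      apply Cmod_prod_le; auto. repeat apply Cmod_prod_le.
      + apply Cmod_qpoch_le.
      + unfold rinv. destruct (n <=? N)%nat; [apply Cmod_inv_le, Cmod_qpoch_ge|rewrite Cmod_0; lra].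
      + apply Cmod_inv_le, Cmod_qpoch_ge.
    - intros n. unfold l.
      (* Written as the limit of one q-factorial over two. The terms agree with this shape only from
         [N >= n] on, where [rinv] is a genuine inverse. *)
      replace ((2 * INR n + 1) * jac q n * / P)%C with ((2 * INR n + 1) * jac q n * (P * (/ P * / P)))%C by (field; auto).
      pose proof (ctends_inv _ _ _ qbound_inv_pos Cmod_qpoch_ge HP) as HI.
      eapply (ctends_ext_from _ _ _ n);
        [|exact (ctends_mult _ _ _ _ (ctends_const ((2 * INR n + 1) * jac q n)%C)
           (ctends_mult _ _ _ _ (ctends_comp _ _ (fun N => (2 * N + 1)%nat) 0 ltac:(intros; cbv beta; lia) HP)
             (ctends_mult _ _ _ _ (ctends_comp _ _ (fun N => (N - n)%nat) n ltac:(intros; cbv beta; lia) HI)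
               (ctends_comp _ _ (fun N => (N + n + 1)%nat) 0 ltac:(intros; cbv beta; lia) HI))))].
      intros N HN. cbv beta. rewrite jac_fin_closed. unfold rinv.
      destruct (Nat.leb_spec n N); try lia. ring.
    - intros N. rewrite <- (jac_fin_sum q N (S N)) by lia. apply is_series_finite.
      intros n Hn. rewrite jac_fin_support by lia. ring. }
  rewrite E in HL.
  apply (is_series_ext (V := C_NormedModule) (fun n => P * l n)%C).
  - intros n. unfold l. match goal with |- ?a = ?b => change (@eq C a b) end. field. auto.
  - replace (P * P * P)%C with (P * (P * P))%C by ring. apply is_series_scal_C. exact HL.
Qed.
End Disk.

(** * The derivative of [theta 1 1] at zero in terms of [eta] *)

Lemma cexp_PI_half : cexp (PI * Ci / 2) = Ci.
Proof.
  replace (PI * Ci / 2)%C with ((0, PI / 2) : C).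
  - unfold cexp; simpl. rewrite exp_0, cos_PI2, sin_PI2. unfold Ci; f_equal; ring.
  - replace (PI * Ci / 2)%C with (RtoC (PI / 2) * Ci)%C by (rewrite RtoC_div by lra; field).
    unfold RtoC, Ci, Cmult; simpl; f_equal; ring.
Qed.

Lemma pow_n_Cpow (x : C) (n : nat) : pow_n x n = (x ^ n)%C.
Proof. induction n as [|n IH]; [reflexivity|]. simpl. rewrite IH. reflexivity. Qed.

Lemma cexp_Cpow (z : C) (n : nat) : (cexp z ^ n)%C = cexp (INR n * z).
Proof.
  induction n as [|n IH].
  - simpl. rewrite <- cexp_0. f_equal. ring.
  - change (cexp z ^ S n)%C with (cexp z * cexp z ^ n)%C. rewrite IH, <- cexp_plus, S_INR, RtoC_plus.
    f_equal. ring.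
Qed.

Lemma jac_q_of (tau : C) (n : nat) :
  jac (q_of tau) n = cexp (PI * Ci * (INR n * (INR n + 1) * tau + INR n)).
Proof.
  induction n as [|n IH].
  - simpl. rewrite <- cexp_0. f_equal. ring.
  - change (jac (q_of tau) (S n)) with (- q_of tau ^ S n * jac (q_of tau) n)%C. rewrite IH.
    unfold q_of at 1. change Defs.Ci with Ci. rewrite cexp_Cpow.
    replace (- cexp (INR (S n) * (RtoC (2 * PI) * (Ci * tau))) * cexp (PI * Ci * (INR n * (INR n + 1) * tau + INR n)))%C
      with ((- (1)) * (cexp (INR (S n) * (RtoC (2 * PI) * (Ci * tau))) * cexp (PI * Ci * (INR n * (INR n + 1) * tau + INR n))))%C by ring.
    rewrite <- cexp_PI, <- !cexp_plus, S_INR, RtoC_plus, RtoC_mult. f_equal. ring.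
Qed.

(** The indices [k] and [-1 - k] give equal contributions, since both [half] and the phase change
    sign. With [p = k + 1/2], [p^2 = k (k + 1) + 1/4] extracts [e^(PI i tau / 4)], the cube of the
    prefactor of [eta], and leaves Jacobi's series in [q]. *)
Lemma theta_11_derivative_eta (tau t0 : C) : 0 < Im tau ->
  is_zseries (fun n => 2 * PI * Ci * half n * theta_term 1 1 0 tau n)%C t0 ->
  t0 = (- (2 * PI) * (eta tau * eta tau * eta tau))%C /\ eta tau <> 0%C.
Proof.
  intros Ht [l1 [l2 [H1 [H2 E]]]].
  pose proof (is_series_plus_C _ _ _ _ H1 H2) as H. rewrite <- E in H. clear E H1 H2 l1 l2.
  assert (Hm : Cmod (q_of tau) = exp (- (PI * Im tau)) * exp (- (PI * Im tau))).
  { unfold q_of. rewrite Cmod_cexp, <- exp_plus. f_equal. destruct tau; simpl; ring. }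
  pose proof PI_RGT_0.
  assert (Hs : 0 < exp (- (PI * Im tau)) < 1).
  { split; [apply exp_pos|]. rewrite <- exp_0. apply exp_increasing.
    assert (0 < PI * Im tau) by (apply Rmult_lt_0_compat; auto). lra. }
  assert (Hq0 : q_of tau <> 0%C) by apply cexp_neq_0.
  destruct (qpoch_converges (q_of tau) _ Hs (Req_le _ _ Hm)) as [P HP].
  pose proof (jacobi_identity (q_of tau) _ Hs (Req_le _ _ Hm) P HP) as HJ.
  assert (HP0 : P <> 0%C).
  { apply Cmod_gt_0. eapply Rlt_le_trans; [apply (qbound_inv_pos _ Hs)|].
    apply (ctends_Cmod_ge _ _ _ (Cmod_qpoch_ge (q_of tau) _ Hs (Req_le _ _ Hm)) HP). }
  assert (He : eta tau = (cexp (PI * Ci * tau / 12) * P)%C).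
  { unfold eta. f_equal.
    - change Defs.Ci with Ci. f_equal. rewrite RtoC_div, RtoC_mult by lra. field.
    - unfold CProd1.
      apply (@iota_filterlim_locally C_AbsRing C_CompleteNormedModule _ eventually _ (partial_prod (fun n => 1 - pow_n (q_of tau) n)%C) P).
      apply ctends_filterlim.
      replace (fun n => 1 - pow_n (q_of tau) n)%C with (fun n => 1 - q_of tau ^ n)%C; [exact HP|].
      apply functional_extensionality. intros n. exact (f_equal (fun z => 1 - z)%C (eq_sym (pow_n_Cpow _ _))). }
  split.
  2:{ rewrite He. apply Cmult_neq_0; auto. apply cexp_neq_0. }
  apply (is_series_unique_C _ _ _ H).
  replace (- (2 * PI) * (eta tau * eta tau * eta tau))%C
    with (- (2 * PI) * cexp (PI * Ci * tau / 4) * (P * P * P))%C.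
  2:{ rewrite He. replace (PI * Ci * tau / 4)%C with (PI * Ci * tau / 12 + PI * Ci * tau / 12 + PI * Ci * tau / 12)%C by field.
      rewrite !cexp_plus. ring. }
  eapply is_series_ext; [|exact (is_series_scal_C (- (2 * PI) * cexp (PI * Ci * tau / 4))%C _ _ HJ)].
  intros k. cbv beta. match goal with |- ?a = ?b => change (@eq C a b) end.
  rewrite !theta_term_11, jac_q_of.
  set (p := (INR k + 1 / 2)%C).
  assert (Hp : RtoC (half (Z.of_nat k)) = p).
  { unfold half, p. rewrite <- INR_IZR_INZ, RtoC_plus, RtoC_div by lra. reflexivity. }
  assert (Hp' : RtoC (half (- Z.of_nat (S k))) = (- p)%C).
  { unfold half, p. rewrite opp_IZR, <- INR_IZR_INZ, S_INR, RtoC_plus, RtoC_opp, RtoC_plus, RtoC_div by lra. field. }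
  rewrite Hp, Hp'.
  replace (2 * PI * Ci * p * 0)%C with (RtoC 0) by ring.
  replace (2 * PI * Ci * - p * 0)%C with (RtoC 0) by ring. rewrite cexp_0.
  assert (E1 : cexp (PI * Ci * (p * p * tau + p)) =
    (Ci * (cexp (PI * Ci * tau / 4) * cexp (PI * Ci * (INR k * (INR k + 1) * tau + INR k))))%C).
  { transitivity (cexp (PI * Ci / 2) * (cexp (PI * Ci * tau / 4) * cexp (PI * Ci * (INR k * (INR k + 1) * tau + INR k))))%C.
    - rewrite <- !cexp_plus. f_equal. unfold p. field.
    - rewrite cexp_PI_half. reflexivity. }
  assert (E2 : cexp (PI * Ci * (- p * - p * tau + - p)) = (- cexp (PI * Ci * (p * p * tau + p)))%C).
  { replace (- cexp (PI * Ci * (p * p * tau + p)))%C with (- (1) * cexp (PI * Ci * (p * p * tau + p)))%C by ring.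
    rewrite <- cexp_PI, <- cexp_plus. apply cexp_eq_mod with (- Z.of_nat (S k))%Z.
    rewrite opp_IZR, <- INR_IZR_INZ, S_INR, RtoC_opp, RtoC_plus. unfold p. field. }
  rewrite E2, E1.
  assert (Hi : (Ci * Ci = - (1))%C) by (unfold Ci, Cmult, Copp, RtoC; simpl; f_equal; ring).
  set (X := cexp (PI * Ci * tau / 4)). set (Y := cexp (PI * Ci * (INR k * (INR k + 1) * tau + INR k))).
  transitivity (- (2 * PI) * X * ((2 * INR k + 1) * Y))%C; [reflexivity|].
  transitivity (4 * PI * p * (X * Y) * (Ci * Ci))%C; [rewrite Hi; unfold p; field|]. ring.
Qed.

Lemma theta_11_lattice (tau v : C) (m n : Z) : 0 < Im tau ->
  theta 1 1 (v + IZR m + IZR n * tau) tau =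
  (cexp (PI * Ci * (IZR m + IZR n - IZR n * IZR n * tau - 2 * IZR n * v)) * theta 1 1 v tau)%C.
Proof.
  intros Ht.
  assert (Hm : forall v, theta 1 1 (v + IZR m) tau = (cexp (PI * Ci * IZR m) * theta 1 1 v tau)%C).
  { revert m. apply (Z.bi_induction (fun m => forall v, theta 1 1 (v + IZR m) tau = (cexp (PI * Ci * IZR m) * theta 1 1 v tau)%C)).
    - intros x y ->. tauto.
    - intros w. replace (w + 0)%C with w by ring. replace (PI * Ci * 0)%C with (RtoC 0) by ring.
      rewrite cexp_0. ring.
    - intros m. rewrite succ_IZR, RtoC_plus.
      replace (PI * Ci * (IZR m + 1))%C with (PI * Ci * IZR m + PI * Ci)%C by ring.
      rewrite cexp_plus, cexp_PI.
      split; intros H w; specialize (H w); replace (w + (IZR m + 1))%C with (w + IZR m + 1)%C in * by ring;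
        rewrite theta_11_plus_1 in * by auto.
      + rewrite H. ring.
      + replace (theta 1 1 (w + IZR m) tau) with (- - theta 1 1 (w + IZR m) tau)%C by ring. rewrite H. ring. }
  assert (Hn : forall v, theta 1 1 (v + IZR n * tau) tau =
     (cexp (PI * Ci * (IZR n - IZR n * IZR n * tau - 2 * IZR n * v)) * theta 1 1 v tau)%C).
  { revert n. apply (Z.bi_induction (fun n => forall v, theta 1 1 (v + IZR n * tau) tau =
     (cexp (PI * Ci * (IZR n - IZR n * IZR n * tau - 2 * IZR n * v)) * theta 1 1 v tau)%C)).
    - intros x y ->. tauto.
    - intros w. replace (w + 0 * tau)%C with w by ring.
      replace (PI * Ci * (0 - 0 * 0 * tau - 2 * 0 * w))%C with (RtoC 0) by ring. rewrite cexp_0. ring.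
    - intros n. rewrite succ_IZR, RtoC_plus.
      assert (Ex : forall w, cexp (PI * Ci * ((IZR n + 1) - (IZR n + 1) * (IZR n + 1) * tau - 2 * (IZR n + 1) * w))
        = (- cexp (- (PI * Ci * (tau + 2 * (w + IZR n * tau)))) * cexp (PI * Ci * (IZR n - IZR n * IZR n * tau - 2 * IZR n * w)))%C).
      { intros w. replace (- cexp (- (PI * Ci * (tau + 2 * (w + IZR n * tau)))))%C
          with (- (1) * cexp (- (PI * Ci * (tau + 2 * (w + IZR n * tau)))))%C by ring.
        rewrite <- cexp_PI, <- !cexp_plus. f_equal. ring. }
      split; intros H w; specialize (H w); rewrite Ex in *;
        replace (w + (IZR n + 1) * tau)%C with (w + IZR n * tau + tau)%C in * by ring;
        rewrite theta_11_plus_tau in * by auto.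
      + rewrite H. ring.
      + set (K := (- cexp (- (PI * Ci * (tau + 2 * (w + IZR n * tau)))))%C) in *.
        assert (HK : K <> 0%C).
        { unfold K. intros E. apply (cexp_neq_0 (- (PI * Ci * (tau + 2 * (w + IZR n * tau))))).
          match goal with |- ?x = _ => replace x with (- - x)%C by ring end. rewrite E. ring. }
        match goal with |- ?x = ?y => replace x with (K * x / K)%C by (field; auto);
          replace y with (K * y / K)%C by (field; auto) end.
        rewrite H. f_equal. ring. }
  rewrite Hn, Hm, Cmult_assoc, <- cexp_plus. f_equal.
  (* The translation by [n * tau] is evaluated at [v + m], which produces the extra phase
     [- 2 PI i n m]. *)
  apply cexp_eq_mod with (- (n * m))%Z. rewrite opp_IZR, mult_IZR, RtoC_opp, RtoC_mult. ring.
Qed.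

(** The factor [e^(PI i v)] makes both functions periodic with multiplier [- fourier_char (-1)].
    Their means [a1], [a2] are nonzero, and [a1 H2 - a2 H1] has mean zero, so it vanishes. *)
Lemma quasi_periodic_proportional (tau : C) (H1 H1' H2 H2' : C -> C) :
  hol H1 H1' -> hol H2 H2' ->
  (forall v, H1 (v + 1) = - H1 v)%C -> (forall v, H2 (v + 1) = - H2 v)%C ->
  (forall v, H1 (v + tau) = - cexp (- (PI * Ci * (tau + 2 * v))) * H1 v)%C ->
  (forall v, H2 (v + tau) = - cexp (- (PI * Ci * (tau + 2 * v))) * H2 v)%C ->
  (exists v, H1 v <> 0%C) -> (exists v, H2 v <> 0%C) ->
  exists c : C, c <> 0%C /\ forall v, H2 v = (c * H1 v)%C.
Proof.
  intros D1 D2 P1 P2 Q1 Q2 [v1 N1] [v2 N2].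
  set (e := fun v : C => cexp (PI * Ci * v)).
  assert (De : hol e (fun v => PI * Ci * e v)%C).
  { eapply hol_ext; [| |exact (hol_comp _ _ _ _ (hol_scal (PI * Ci)%C _ _ hol_id) hol_cexp)];
      intros v; unfold e; simpl; ring. }
  assert (Hgen : forall H H', hol H H' -> (forall v, H (v + 1) = - H v)%C ->
    (forall v, H (v + tau) = - cexp (- (PI * Ci * (tau + 2 * v))) * H v)%C ->
    cint (fun t => H t * e t)%C = 0%C -> forall v, H v = 0%C).
  { intros H H' D P Q H0 v.
    assert (E : (H v * e v)%C = 0%C).
    { refine (quasi_periodic_uniqueness tau (- (1))%C (fun v => H v * e v)%C _ _ (hol_mult _ _ _ _ D De) _ _ H0 v).
      - intros E. apply (f_equal Re) in E. simpl in E. lra.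
      - intros w. rewrite P. unfold e. replace (PI * Ci * (w + 1))%C with (PI * Ci * w + PI * Ci)%C by ring.
        rewrite cexp_plus, cexp_PI. ring.
      - intros w. rewrite Q. unfold e, fourier_char.
        replace (PI * Ci * (w + tau))%C with (PI * Ci * w + PI * Ci * tau)%C by ring.
        rewrite cexp_plus.
        replace (- cexp (- (PI * Ci * (tau + 2 * w))) * H w * (cexp (PI * Ci * w) * cexp (PI * Ci * tau)))%C
          with (- (1) * (cexp (- (PI * Ci * (tau + 2 * w))) * cexp (PI * Ci * tau)) * (H w * cexp (PI * Ci * w)))%C by ring.
        rewrite <- cexp_plus. do 3 f_equal. ring. }
    destruct (Ceq_dec (H v) 0%C) as [?|Hn]; auto. exfalso. revert E. apply Cmult_neq_0; auto. apply cexp_neq_0. }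
  set (a1 := cint (fun t => H1 t * e t)%C). set (a2 := cint (fun t => H2 t * e t)%C).
  assert (A1 : a1 <> 0%C) by (intros E; apply N1, (Hgen H1 H1'); auto).
  assert (A2 : a2 <> 0%C) by (intros E; apply N2, (Hgen H2 H2'); auto).
  assert (Hr : forall H H', hol H H' -> rcont (fun t : R => H t * e t)%C).
  { intros H H' D. replace (fun t : R => H t * e t)%C with (fun t : R => H (t + 0) * e (t + 0))%C.
    - exact (hol_rcont _ _ 0 (hol_mult _ _ _ _ D De)).
    - apply functional_extensionality; intros t. f_equal; f_equal; ring. }
  assert (HD : forall v, (a1 * H2 v - a2 * H1 v)%C = 0%C).
  { refine (Hgen (fun v => a1 * H2 v - a2 * H1 v)%C _ (hol_minus _ _ _ _ (hol_scal a1 _ _ D2) (hol_scal a2 _ _ D1)) _ _ _).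
    - intros v. rewrite P1, P2. ring.
    - intros v. rewrite Q1, Q2. ring.
    - rewrite (cint_ext _ (fun t : R => a1 * (H2 t * e t) + - a2 * (H1 t * e t))%C) by (intros; ring).
      pose proof (Hr _ _ D1) as r1. pose proof (Hr _ _ D2) as r2.
      rewrite (cint_plus _ _ (rcont_mult _ _ (rcont_const a1) r2) (rcont_mult _ _ (rcont_const (- a2)%C) r1)).
      rewrite !cint_scal by assumption. fold a1 a2. ring. }
  exists (a2 / a1)%C. split.
  - unfold Cdiv. apply Cmult_neq_0; auto. intros E. apply A1.
    replace a1 with (a1 * a1 * / a1)%C by (field; auto). rewrite E. ring.
  - intros v. specialize (HD v).
    replace (H2 v) with ((a1 * H2 v - a2 * H1 v + a2 * H1 v) / a1)%C by (field; auto).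
    rewrite HD. field. auto.
Qed.

Lemma hol_derivative_unique (f f1 f2 : C -> C) (v : C) : hol f f1 -> hol f f2 -> f1 v = f2 v.
Proof.
  intros D1 D2.
  destruct (D1 (Cmod v + 1)) as [K1 [HK1 H1]]. destruct (D2 (Cmod v + 1)) as [K2 [HK2 H2]].
  pose proof (Cmod_ge_0 v).
  assert (Hb : forall t, 0 < t <= 1 -> Cmod (f2 v - f1 v) <= (K1 + K2) * t).
  { intros t Ht. assert (Cmod t = t) by (rewrite Cmod_R, Rabs_right; lra).
    destruct (H1 v (RtoC t) ltac:(lra) ltac:(lra)) as [_ [_ c1]].
    destruct (H2 v (RtoC t) ltac:(lra) ltac:(lra)) as [_ [_ c2]].
    apply Rmult_le_reg_l with t; [lra|]. rewrite <- H0 at 1. rewrite <- Cmod_mult.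
    replace (t * (f2 v - f1 v))%C with ((f (v + t) - f v - t * f1 v) + - (f (v + t) - f v - t * f2 v))%C by ring.
    replace (t * ((K1 + K2) * t)) with (K1 * (t * t) + K2 * (t * t)) by ring.
    rewrite !H0 in *. apply Cmod_sum_le; [|rewrite Cmod_opp]; auto. }
  assert (E : Cmod (f2 v - f1 v) = 0).
  { apply Rle_antisym; [|apply Cmod_ge_0]. apply Rnot_lt_le. intros Hlt.
    set (x := Cmod (f2 v - f1 v)) in *. set (t := Rmin 1 (x / (2 * (K1 + K2 + 1)))).
    assert (0 < t) by (apply Rmin_pos; [lra|apply Rdiv_lt_0_compat; lra]).
    assert (t <= 1) by apply Rmin_l.
    specialize (Hb t ltac:(lra)).
    assert (t * (2 * (K1 + K2 + 1)) <= x).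
    { apply Rle_trans with (x / (2 * (K1 + K2 + 1)) * (2 * (K1 + K2 + 1))); [|right; field; lra].
      apply Rmult_le_compat_r; [lra|apply Rmin_r]. }
    nra. }
  apply Cmod_eq_0 in E. replace (f1 v) with (f2 v - (f2 v - f1 v))%C by ring. rewrite E. ring.
Qed.

(** * Modular transformation *)

Lemma automorphy_factor_neq_0 (a b c d : Z) (tau : C) :
  (a * d - b * c = 1)%Z -> 0 < Im tau -> (IZR c * tau + IZR d)%C <> 0%C.
Proof.
  intros Hdet Ht E. destruct tau as [x y]. simpl in Ht.
  pose proof (f_equal Re E) as E1. pose proof (f_equal Im E) as E2. simpl in E1, E2.
  assert (Hc : IZR c * y = 0) by lra.
  apply Rmult_integral in Hc. destruct Hc as [Hc|Hc]; [|lra].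
  rewrite Hc in E1. assert (Hd : IZR d = 0) by lra.
  apply eq_IZR in Hc, Hd. subst. lia.
Qed.

Lemma Im_moeb_pos (a b c d : Z) (tau : C) :
  (a * d - b * c = 1)%Z -> 0 < Im tau -> 0 < Im (moeb a b c d tau).
Proof.
  intros Hdet Ht. pose proof (automorphy_factor_neq_0 a b c d tau Hdet Ht) as Hj.
  destruct tau as [x y]. simpl in Ht.
  apply (f_equal IZR) in Hdet. rewrite minus_IZR, !mult_IZR in Hdet.
  set (N := (IZR c * x + IZR d) ^ 2 + (IZR c * y) ^ 2).
  assert (HN : 0 < N).
  { destruct (Rle_lt_dec N 0) as [Hn|]; auto. exfalso. apply Hj.
    unfold N in Hn. assert (IZR c * x + IZR d = 0) by nra. assert (IZR c * y = 0) by nra.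
    unfold Cplus, Cmult, RtoC; simpl. f_equal; lra. }
  assert (E : Im (moeb a b c d (x, y)) = y / N).
  { unfold moeb, Cdiv, Cinv, Cplus, Cmult, RtoC; simpl.
    replace (y / N) with (y * (IZR a * IZR d - IZR b * IZR c) / N) by (rewrite Hdet; field; lra).
    unfold N in *. field. simpl in HN. intros h. rewrite <- h in HN. ring_simplify in HN. lra. }
  rewrite E. apply Rdiv_lt_0_compat; auto.
Qed.

(** Modulo 2 the number is [(a + 1) (c + 1) - 1]. It is the exponent of the sign in the two
    quasi-periodicity checks, where it is applied to the columns of a matrix of determinant 1. *)
Lemma not_both_even (a c : Z) : ~ (Z.Even a /\ Z.Even c) ->
  exists k, (a - c - a * c = 1 + 2 * k)%Z.
Proof.
  intros H. destruct (Z.Even_or_Odd a) as [Ha|[a' Ha]].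
  - destruct (Z.Even_or_Odd c) as [Hc|[c' Hc]]; [tauto|].
    exists ((a - 1) * (c' + 1) - a * c)%Z. subst c. ring.
  - exists (a' * (c + 1) - a * c)%Z. subst a. ring.
Qed.

(** The same [K] governs all values of [v] and the cube of [eta]; this sharing is what lets it
    cancel in [F]. *)
Lemma theta_11_modular (a b c d : Z) (tau : C) :
  (a * d - b * c = 1)%Z -> 0 < Im tau ->
  let j := (IZR c * tau + IZR d)%C in
  let tau' := moeb a b c d tau in
  exists K : C, K <> 0%C /\
    (forall v : C, (cexp (- (PI * Ci * IZR c * (v * v) / j)) * theta 1 1 (v / j) tau' = K * theta 1 1 v tau)%C) /\
    (eta tau' * eta tau' * eta tau' = j * K * (eta tau * eta tau * eta tau))%C.
Proof.
  intros Hdet Ht j tau'.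
  assert (Hj : j <> 0%C) by (apply automorphy_factor_neq_0 with a b; auto).
  assert (Ht' : 0 < Im tau') by (apply Im_moeb_pos; auto).
  assert (Htau' : (tau' * j = IZR a * tau + IZR b)%C) by (unfold tau', moeb; fold j; field; auto).
  assert (HdetC : (IZR a * IZR d - IZR b * IZR c = 1)%C).
  { rewrite <- !RtoC_mult, <- RtoC_minus, <- !mult_IZR, <- minus_IZR, Hdet. reflexivity. }
  destruct (not_both_even a c) as [k Hk].
  { intros [[a' Ha] [c' Hc]]. subst. lia. }
  destruct (not_both_even d b) as [l Hl].
  { intros [[d' Hd] [b' Hb]]. subst. lia. }
  assert (HkC : (IZR a - IZR c - IZR a * IZR c = 1 + 2 * IZR k)%C).
  { rewrite <- !RtoC_mult, <- !RtoC_minus, <- RtoC_plus, <- !mult_IZR, <- !minus_IZR, <- plus_IZR, Hk. reflexivity. }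
  assert (HlC : (IZR d - IZR b - IZR d * IZR b = 1 + 2 * IZR l)%C).
  { rewrite <- !RtoC_mult, <- !RtoC_minus, <- RtoC_plus, <- !mult_IZR, <- !minus_IZR, <- plus_IZR, Hl. reflexivity. }
  destruct (theta_11_hol tau Ht) as [T [D1 [_ Z1]]].
  destruct (theta_11_hol tau' Ht') as [T' [D2 [_ Z2]]].
  destruct (theta_11_derivative_eta tau _ Ht (Z1 0%C)) as [E1 N1].
  destruct (theta_11_derivative_eta tau' _ Ht' (Z2 0%C)) as [E2 N2].
  assert (HPI : RtoC PI <> 0%C) by apply PI_neq_0_C.
  (* A function vanishing identically would have derivative zero at [0], against the nonzero
     multiple of the cube of [eta]. *)
  assert (Hne : forall (f f' : C -> C) (e : C), hol f f' -> f' 0 = (- (2 * PI) * (e * e * e))%C -> e <> 0%C ->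
    exists v, f v <> 0%C).
  { intros f f' e D E N. destruct (classic (exists v, f v <> 0%C)) as [?|Hno]; auto. exfalso.
    assert (f' 0 = 0%C).
    { rewrite (hol_derivative_unique f f' (fun _ => 0%C) 0 D); auto.
      eapply hol_ext; [| |exact (hol_const 0%C)]; intros v; auto.
      destruct (Ceq_dec (f v) 0%C) as [->|Hv]; auto. exfalso; eauto. }
    rewrite H in E. revert E.
    assert (Hx : (- (2 * PI) * (e * e * e))%C <> 0%C).
    { repeat apply Cmult_neq_0; auto. intros E. apply HPI.
      replace (RtoC PI) with (- (- (2 * PI)) / 2)%C by field. rewrite E. field. }
    intros E. apply Hx. auto. }
  set (g := fun v => cexp (- (PI * Ci * IZR c / j) * (v * v))%C).
  set (H := fun v => (g v * theta 1 1 (/ j * v) tau')%C).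
  pose proof (hol_comp _ _ _ _ (hol_scal (- (PI * Ci * IZR c / j))%C _ _ (hol_mult _ _ _ _ hol_id hol_id)) hol_cexp) as Dg.
  pose proof (hol_mult _ _ _ _ Dg (hol_comp _ _ _ _ (hol_scal (/ j)%C _ _ hol_id) D2)) as DH.
  cbv beta in DH.
  match type of DH with hol _ ?f => set (H' := f) in DH end.
  change (hol H H') in DH.
  assert (HP : forall v, H (v + 1)%C = (- H v)%C).
  { intros v. unfold H, g.
    (* The step [1 / j] is the lattice vector [a - c tau'] for [tau'], because [j (a - c tau')] is
       the determinant. Likewise [tau / j = - b + d tau'] below. *)
    replace (/ j * (v + 1))%C with (/ j * v + IZR a + IZR (- c) * tau')%C.
    2:{ rewrite opp_IZR, RtoC_opp.
        assert (E : RtoC 1 = (j * (IZR a - IZR c * tau'))%C).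
        { replace (j * (IZR a - IZR c * tau'))%C with (j * IZR a - IZR c * (tau' * j))%C by ring.
          rewrite Htau', <- HdetC. unfold j. ring. }
        rewrite E at 1. field. auto. }
    rewrite theta_11_lattice by auto.
    rewrite Cmult_assoc, <- cexp_plus.
    replace (- (cexp (- (PI * Ci * IZR c / j) * (v * v)) * theta 1 1 (/ j * v) tau'))%C
      with ((- (1) * cexp (- (PI * Ci * IZR c / j) * (v * v))) * theta 1 1 (/ j * v) tau')%C by ring.
    f_equal. rewrite <- cexp_PI, <- cexp_plus. apply cexp_eq_mod with k.
    rewrite opp_IZR, RtoC_opp.
    assert (E : (IZR c / j = IZR a * IZR c - IZR c * IZR c * tau')%C).
    { replace (IZR a * IZR c - IZR c * IZR c * tau')%C with (IZR c * (j * IZR a - IZR c * (tau' * j)) / j)%C by (field; auto).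
      rewrite Htau'. replace (j * IZR a - IZR c * (IZR a * tau + IZR b))%C with (IZR a * IZR d - IZR b * IZR c)%C by (unfold j; ring).
      rewrite HdetC. field. auto. }
    transitivity (PI * Ci * ((IZR a - IZR c - IZR a * IZR c) + (IZR a * IZR c - IZR c * IZR c * tau' - IZR c / j))
       + - (PI * Ci * IZR c / j) * (v * v))%C; [field; auto|].
    rewrite <- E, HkC. ring. }
  assert (HQ : forall v, H (v + tau)%C = (- cexp (- (PI * Ci * (tau + 2 * v))) * H v)%C).
  { intros v. unfold H, g.
    assert (Ed : (IZR d * (IZR a * tau + IZR b) - IZR b * j = tau)%C).
    { transitivity ((IZR a * IZR d - IZR b * IZR c) * tau)%C; [unfold j; ring|]. rewrite HdetC. ring. }
    replace (/ j * (v + tau))%C with (/ j * v + IZR (- b) + IZR d * tau')%C.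
    2:{ rewrite opp_IZR, RtoC_opp. rewrite <- Ed. rewrite <- Htau'. field. auto. }
    rewrite theta_11_lattice by auto.
    rewrite Cmult_assoc, <- cexp_plus.
    replace (- cexp (- (PI * Ci * (tau + 2 * v))) * (cexp (- (PI * Ci * IZR c / j) * (v * v)) * theta 1 1 (/ j * v) tau'))%C
      with ((- (1) * (cexp (- (PI * Ci * (tau + 2 * v))) * cexp (- (PI * Ci * IZR c / j) * (v * v)))) * theta 1 1 (/ j * v) tau')%C by ring.
    f_equal. rewrite <- cexp_PI, <- !cexp_plus. apply cexp_eq_mod with l.
    rewrite opp_IZR, RtoC_opp.
    assert (Ec : (IZR c * tau = j - IZR d)%C) by (unfold j; ring).
    assert (Et : (tau' = (IZR a * tau + IZR b) / j)%C) by (rewrite <- Htau'; field; auto).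
    assert (E : (IZR d * IZR d * tau' + IZR c * tau * tau / j = tau + IZR d * IZR b)%C).
    { rewrite Et. replace (IZR d * IZR d * ((IZR a * tau + IZR b) / j) + IZR c * tau * tau / j)%C
        with ((IZR d * (IZR d * (IZR a * tau + IZR b) - IZR b * j) + IZR c * tau * tau) / j + IZR d * IZR b)%C by (field; auto).
      rewrite Ed, Ec. field. auto. }
    transitivity (PI * Ci * ((IZR d - IZR b) - (IZR d * IZR d * tau' + IZR c * tau * tau / j) - 2 * v * ((IZR c * tau + IZR d) / j))
       + - (PI * Ci * IZR c / j) * (v * v))%C; [field; auto|].
    rewrite E. fold j. replace (j / j)%C with (RtoC 1) by (field; auto).
    replace (IZR d - IZR b - (tau + IZR d * IZR b) - 2 * v * 1)%C with ((IZR d - IZR b - IZR d * IZR b) - tau - 2 * v)%C by ring.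
    rewrite HlC. ring. }
  assert (HN : exists v, H v <> 0%C).
  { destruct (Hne _ _ _ D2 E2 N2) as [v Hv]. exists (j * v)%C. unfold H, g.
    replace (/ j * (j * v))%C with v by (field; auto). apply Cmult_neq_0; auto. apply cexp_neq_0. }
  destruct (quasi_periodic_proportional tau _ _ _ _ D1 DH (fun v => theta_11_plus_1 v tau Ht) HP
     (fun v => theta_11_plus_tau v tau Ht) HQ (Hne _ _ _ D1 E1 N1) HN) as [K [HK HKv]].
  exists K. split; auto. split.
  - intros v. rewrite <- HKv. unfold H, g. f_equal.
    + f_equal. field. auto.
    + f_equal. field. auto.
  - assert (E : H' 0 = (K * T 0)%C).
    { apply (hol_derivative_unique H H' (fun v => K * T v)%C 0 DH).
      eapply hol_ext; [| |exact (hol_scal K _ _ D1)]; intros v; simpl; auto. }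
    (* The Gaussian factor has value 1 and derivative 0 at the origin, so only the inner derivative
       [1 / j] of [v / j] appears. *)
    unfold H' in E. rewrite !Cmult_0_r, cexp_0, E1, E2 in E.
    assert (E3 : (/ j * (- (2 * PI) * (eta tau' * eta tau' * eta tau')) = K * (- (2 * PI) * (eta tau * eta tau * eta tau)))%C).
    { rewrite <- E. ring. }
    replace (eta tau' * eta tau' * eta tau')%C with
      (/ j * (- (2 * PI) * (eta tau' * eta tau' * eta tau')) * j / (- (2 * PI)))%C.
    + rewrite E3. field. auto.
    + field. auto.
Qed.

(* A Klein form, up to a factor depending only on [tau]: this normalisation makes the modular group act on the characteristic [(r, s)] by right multiplication. *)
Definition klein (r s : R) (tau : C) : C :=
  (cexp (PI * Ci * r * (r * tau + s)) * theta 1 1 (r * tau + s) tau)%C.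

Lemma klein_opp (r s : R) (tau : C) : 0 < Im tau -> klein (- r) (- s) tau = (- klein r s tau)%C.
Proof.
  intros Ht. unfold klein. rewrite !RtoC_opp.
  replace (- r * tau + - s)%C with (- (r * tau + s))%C by ring.
  rewrite theta_11_odd by auto.
  replace (PI * Ci * - r * - (r * tau + s))%C with (PI * Ci * r * (r * tau + s))%C by ring. ring.
Qed.

Lemma klein_shift (r s : R) (n m : Z) (tau : C) : 0 < Im tau ->
  klein (r + IZR n) (s + IZR m) tau =
  (cexp (PI * Ci * (IZR m + IZR n + IZR n * IZR m + r * IZR m - s * IZR n)) * klein r s tau)%C.
Proof.
  intros Ht. unfold klein. rewrite !RtoC_plus.
  replace ((r + IZR n) * tau + (s + IZR m))%C with (r * tau + s + IZR m + IZR n * tau)%C by ring.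
  rewrite theta_11_lattice by auto. rewrite !Cmult_assoc, <- !cexp_plus. f_equal. f_equal. ring.
Qed.

(** The point [v = j (r tau' + s)] has characteristic [(r, s) M] over [tau]. By
    [r + c v = j (r a + s c)] the prefactor of [klein] absorbs the Gaussian exactly, so [K] is the
    only factor. *)
Lemma klein_modular (a b c d : Z) (tau K : C) (r s : R) :
  (a * d - b * c = 1)%Z -> 0 < Im tau ->
  let j := (IZR c * tau + IZR d)%C in
  let tau' := moeb a b c d tau in
  (forall v : C, (cexp (- (PI * Ci * IZR c * (v * v) / j)) * theta 1 1 (v / j) tau' = K * theta 1 1 v tau)%C) ->
  klein r s tau' = (K * klein (r * IZR a + s * IZR c) (r * IZR b + s * IZR d) tau)%C.
Proof.
  intros Hdet Ht j tau' HK.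
  assert (Hj : j <> 0%C) by (apply automorphy_factor_neq_0 with a b; auto).
  assert (Htau' : (tau' * j = IZR a * tau + IZR b)%C) by (unfold tau', moeb; fold j; field; auto).
  assert (HdetC : (IZR a * IZR d - IZR b * IZR c = 1)%C).
  { rewrite <- !RtoC_mult, <- RtoC_minus, <- !mult_IZR, <- minus_IZR, Hdet. reflexivity. }
  unfold klein. rewrite !RtoC_plus, !RtoC_mult.
  set (v := ((r * IZR a + s * IZR c) * tau + (r * IZR b + s * IZR d))%C).
  assert (Hv : (r * tau' + s = v / j)%C).
  { replace (r * tau' + s)%C with ((r * (tau' * j) + s * j) / j)%C by (field; auto).
    rewrite Htau'. f_equal. unfold v, j. ring. }
  rewrite Hv.
  replace (K * (cexp (PI * Ci * (r * IZR a + s * IZR c) * v) * theta 1 1 v tau))%C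
    with (cexp (PI * Ci * (r * IZR a + s * IZR c) * v) * (K * theta 1 1 v tau))%C by ring.
  rewrite <- HK, Cmult_assoc, <- cexp_plus. f_equal. f_equal.
  assert (E : (r + IZR c * v = j * (r * IZR a + s * IZR c))%C).
  { transitivity (r * (IZR a * IZR d - IZR b * IZR c) + IZR c * v)%C; [rewrite HdetC; ring|].
    unfold v, j. ring. }
  transitivity (PI * Ci * (r + IZR c * v) * v / j + - (PI * Ci * IZR c * (v * v) / j))%C; [field; auto|].
  rewrite E. field. auto.
Qed.

(** Passing from characteristic [(1, 1)] to [(1 + 2 r, 1 + 2 s)] translates [v] by [r tau + s];
    [1/5] corresponds to [r = -2/5], and [e'] to [s = (e' - 1) / 2]. *)
Lemma theta_klein (e' : R) (tau : C) : 0 < Im tau ->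
  theta (1 / 5) e' 0 tau =
  (cexp (PI * Ci * (- (2 / 5) * e' + 2 / 5 * ((e' - 1) / 2))) * klein (- (2 / 5)) ((e' - 1) / 2) tau)%C.
Proof.
  intros Ht. destruct (theta_11_hol tau Ht) as [T [_ [Z _]]]. unfold klein.
  rewrite Cmult_assoc, <- cexp_plus.
  apply theta_unique. eapply is_zseries_ext; [|exact (is_zseries_scal _ _ _ (Z _))].
  intros n. cbv beta. rewrite theta_term_11, <- !cexp_plus. unfold theta_term. change Defs.Ci with Ci.
  f_equal. unfold half.
  repeat first [rewrite RtoC_plus | rewrite RtoC_mult | rewrite RtoC_minus | rewrite RtoC_opp | rewrite RtoC_div by lra].
  field.
Qed.

Lemma F_klein (tau : C) : 0 < Im tau ->
  F tau = (pow_n (eta tau) 6 / (cexp (- (4 / 5 * PI * Ci)) * (klein (- (2 / 5)) (- (2 / 5)) tau * klein (- (2 / 5)) (2 / 5) tau)))%C.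
Proof.
  intros Ht. unfold F. rewrite !theta_klein by auto.
  replace ((1 / 5 - 1) / 2) with (- (2 / 5)) by field. replace ((9 / 5 - 1) / 2) with (2 / 5) by field.
  f_equal.
  match goal with |- (?x * ?y * (?z * ?w))%C = _ => replace (x * y * (z * w))%C with ((x * z) * (y * w))%C by ring end.
  rewrite <- cexp_plus. f_equal. f_equal.
  repeat first [rewrite RtoC_plus | rewrite RtoC_mult | rewrite RtoC_minus | rewrite RtoC_opp | rewrite RtoC_div by lra].
  field.
Qed.

(** If the product of Klein forms vanishes, both sides of the transformation law are quotients by
    [0], and this convention makes them equal. *)
Lemma Cdiv_0_r (x : C) : (x / 0 = 0)%C.
Proof. unfold Cdiv, Cinv, Cmult, RtoC, Rdiv; simpl. f_equal; ring. Qed.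

(** What is left to compute is the phase [X] of the product of Klein forms. It stands in the
    denominator, hence the sign in [- X], and counts only modulo 2. *)
Lemma F_modular_of_klein (a b c d : Z) (tau : C) (X : R) (m : Z) :
  (a * d - b * c = 1)%Z -> 0 < Im tau ->
  (klein (- (2 / 5) * IZR a + - (2 / 5) * IZR c) (- (2 / 5) * IZR b + - (2 / 5) * IZR d) tau
   * klein (- (2 / 5) * IZR a + 2 / 5 * IZR c) (- (2 / 5) * IZR b + 2 / 5 * IZR d) tau
   = cexp (PI * Ci * X) * (klein (- (2 / 5)) (- (2 / 5)) tau * klein (- (2 / 5)) (2 / 5) tau))%C ->
  fM a b c d / 5 = - X + 2 * IZR m ->
  F (moeb a b c d tau) =
    Cmult (Cmult (nuF a b c d) (pow_n (Cplus (Cmult (IZR c) tau) (IZR d)) 2)) (F tau).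
Proof.
  intros Hdet Ht HX Hf.
  destruct (theta_11_modular a b c d tau Hdet Ht) as [K [HK [HKv HKe]]].
  pose proof (Im_moeb_pos a b c d tau Hdet Ht) as Ht'.
  rewrite !F_klein by auto.
  rewrite !(klein_modular a b c d tau K) by auto.
  set (j := (IZR c * tau + IZR d)%C) in *.
  set (e := eta tau) in *. set (e' := eta (moeb a b c d tau)) in *.
  set (k1 := klein (- (2 / 5)) (- (2 / 5)) tau) in *. set (k2 := klein (- (2 / 5)) (2 / 5) tau) in *.
  set (k1' := klein (- (2 / 5) * IZR a + - (2 / 5) * IZR c) (- (2 / 5) * IZR b + - (2 / 5) * IZR d) tau) in *.
  set (k2' := klein (- (2 / 5) * IZR a + 2 / 5 * IZR c) (- (2 / 5) * IZR b + 2 / 5 * IZR d) tau) in *.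
  assert (He : forall x : C, pow_n x 6 = ((x * x * x) * (x * x * x))%C).
  { intros x. rewrite pow_n_Cpow. simpl. ring. }
  assert (Hj2 : pow_n j 2 = (j * j)%C) by (rewrite pow_n_Cpow; simpl; ring).
  rewrite !He, HKe, Hj2.
  replace (K * k1' * (K * k2'))%C with (K * K * (k1' * k2'))%C by ring. rewrite HX.
  assert (Hnu : nuF a b c d = (/ cexp (PI * Ci * X))%C).
  { unfold nuF. rewrite <- cexp_opp. apply cexp_eq_mod with m. change Defs.Ci with Ci.
    replace (PI * fM a b c d / 5) with (PI * (- X + 2 * IZR m)) by (rewrite <- Hf; field).
    rewrite RtoC_mult, RtoC_plus, RtoC_opp, RtoC_mult. ring. }
  rewrite Hnu. set (E := cexp (PI * Ci * X)). set (p := cexp (- (4 / 5 * PI * Ci))).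
  assert (HE : E <> 0%C) by apply cexp_neq_0. assert (Hp : p <> 0%C) by apply cexp_neq_0.
  destruct (Ceq_dec (k1 * k2)%C 0%C) as [Z|Z].
  - rewrite Z. replace (p * (K * K * (E * 0)))%C with (RtoC 0) by ring.
    replace (p * 0)%C with (RtoC 0) by ring. rewrite !Cdiv_0_r. ring.
  - assert (k1 <> 0%C) by (intros h; apply Z; rewrite h; ring).
    assert (k2 <> 0%C) by (intros h; apply Z; rewrite h; ring).
    field. repeat split; auto.
Qed.

(** * The four residue classes modulo 5 *)

Lemma mod_5_eq (x r : Z) : (x mod 5 = r mod 5)%Z -> exists k, x = (r + 5 * k)%Z.
Proof.
  intros H. exists (x / 5 - r / 5)%Z.
  pose proof (Z.div_mod x 5 ltac:(lia)). pose proof (Z.div_mod r 5 ltac:(lia)). lia.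
Qed.

Ltac push_IZR := repeat first [rewrite opp_IZR | rewrite plus_IZR | rewrite minus_IZR | rewrite mult_IZR].

Theorem mainTheorem4 :
  forall (a b c d : Z), in_Gamma_theta5 a b c d ->
  forall tau : C, 0 < Im tau ->
    F (moeb a b c d tau) =
    Cmult (Cmult (nuF a b c d)
                 (pow_n (Cplus (Cmult (IZR c) tau) (IZR d)) 2))
          (F tau).
Proof.
  intros a b c d [Hdet Hcong] tau Ht.
  assert (Hshift : forall (r s r' s' : R) (n m : Z), r' = r + IZR n -> s' = s + IZR m ->
     klein r' s' tau = (cexp (PI * Ci * (IZR m + IZR n + IZR n * IZR m + r * IZR m - s * IZR n)%R) * klein r s tau)%C).
  { intros r s r' s' n m -> ->. rewrite klein_shift by auto. f_equal. f_equal.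
    rewrite !RtoC_minus, !RtoC_plus, !RtoC_mult. ring. }
  assert (Hneg1 : klein (2 / 5) (2 / 5) tau = (cexp (PI * Ci * 1%R) * klein (- (2 / 5)) (- (2 / 5)) tau)%C).
  { rewrite klein_opp by auto. replace (PI * Ci * 1)%C with (PI * Ci)%C by ring. rewrite cexp_PI. ring. }
  assert (Hneg2 : klein (2 / 5) (- (2 / 5)) tau = (cexp (PI * Ci * 1%R) * klein (- (2 / 5)) (2 / 5) tau)%C).
  { rewrite <- (Ropp_involutive (2 / 5)) at 1. rewrite klein_opp by auto.
    replace (PI * Ci * 1)%C with (PI * Ci)%C by ring. rewrite cexp_PI. ring. }
  assert (Hadd : forall x y : R, cexp (PI * Ci * (x + y)%R) = (cexp (PI * Ci * x) * cexp (PI * Ci * y))%C).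
  { intros x y. rewrite <- cexp_plus, RtoC_plus. f_equal. ring. }
  pose (ph := fun (r s : R) (n m : Z) => IZR m + IZR n + IZR n * IZR m + r * IZR m - s * IZR n).
  change (forall (r s r' s' : R) (n m : Z), r' = r + IZR n -> s' = s + IZR m ->
     klein r' s' tau = (cexp (PI * Ci * ph r s n m) * klein r s tau)%C) in Hshift.
  destruct Hcong as [[Ha [Hb [Hc Hd]]]|[[Ha [Hb [Hc Hd]]]|[[Ha [Hb [Hc Hd]]]|[Ha [Hb [Hc Hd]]]]]];
  (* With the residues substituted, the boolean tests in [fM] are closed terms, and computation
     selects the branch of the class. *)
  assert (HfM := eq_refl (fM a b c d)); unfold fM at 2, cong5b in HfM; rewrite Ha, Hb, Hc, Hd in HfM;
  cbv - [IZR Rplus Rmult Ropp Rinv Rdiv Rminus fM] in HfM;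
  destruct (mod_5_eq _ _ Ha) as [a' Ha']; destruct (mod_5_eq _ _ Hb) as [b' Hb'];
  destruct (mod_5_eq _ _ Hc) as [c' Hc']; destruct (mod_5_eq _ _ Hd) as [d' Hd'];
  clear Ha Hb Hc Hd;
  (* The multiples of 5 in the entries turn [2/5] into integers: [(n, m)] and [(n2, m2)] are the
     translations of the two characteristics. They have the same form in all four classes and are
     even. *)
  pose (n := (- 2 * (a' + c'))%Z); pose (m := (- 2 * (b' + d'))%Z);
  pose (n2 := (2 * (c' - a'))%Z); pose (m2 := (2 * (d' - b'))%Z);
  (* [2 * S] collects [n + m + n m] and [n2 + m2 + n2 m2] from the two phases, together with
     [8 (a' b' + c' d')] from the products in [fM] divided by 5. Each class adds its own linear
     correction. *)
  pose (S := ((a' + c') * (2 * (b' + d') - 1) - (b' + d') + (c' - a') * (2 * (d' - b') + 1) + (d' - b') + 4 * a' * b' + 4 * c' * d')%Z).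
  - apply F_modular_of_klein with (ph (- (2 / 5)) (- (2 / 5)) n m + ph (- (2 / 5)) (2 / 5) n2 m2) (S + 2 * b')%Z; auto.
    + etransitivity; [apply (f_equal2 Cmult); [apply (Hshift (- (2 / 5)) (- (2 / 5)) _ _ n m)|apply (Hshift (- (2 / 5)) (2 / 5) _ _ n2 m2)];
        unfold n, m, n2, m2; rewrite ?Ha', ?Hb', ?Hc', ?Hd'; push_IZR; field|].
      rewrite Hadd; ring.
    + rewrite HfM. unfold ph, S, n, m, n2, m2. rewrite Ha', Hb', Hc', Hd'. push_IZR. field.
  (* Modulo integers both characteristics change sign; oddness contributes one [+ 1] for each. *)
  - apply F_modular_of_klein with (ph (2 / 5) (2 / 5) n m + 1 + (ph (2 / 5) (- (2 / 5)) n2 m2 + 1)) (S + 1 - b')%Z; auto.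
    + etransitivity; [apply (f_equal2 Cmult); [apply (Hshift (2 / 5) (2 / 5) _ _ n m)|apply (Hshift (2 / 5) (- (2 / 5)) _ _ n2 m2)];
        unfold n, m, n2, m2; rewrite ?Ha', ?Hb', ?Hc', ?Hd'; push_IZR; field|].
      rewrite Hneg1, Hneg2, !Hadd; ring.
    + rewrite HfM. unfold ph, S, n, m, n2, m2. rewrite Ha', Hb', Hc', Hd'. push_IZR. field.
  (* The first characteristic goes to the second and the second to minus the first: the factors
     trade places with a single sign. *)
  - apply F_modular_of_klein with (ph (- (2 / 5)) (2 / 5) n m + (ph (2 / 5) (2 / 5) n2 m2 + 1)) (S + 1 + 2 * d')%Z; auto.
    + etransitivity; [apply (f_equal2 Cmult); [apply (Hshift (- (2 / 5)) (2 / 5) _ _ n m)|apply (Hshift (2 / 5) (2 / 5) _ _ n2 m2)];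
        unfold n, m, n2, m2; rewrite ?Ha', ?Hb', ?Hc', ?Hd'; push_IZR; field|].
      rewrite Hneg1, !Hadd; ring.
    + rewrite HfM. unfold ph, S, n, m, n2, m2. rewrite Ha', Hb', Hc', Hd'. push_IZR. field.
  (* The inverse exchange: the first characteristic goes to minus the second, the second to the
     first. *)
  - apply F_modular_of_klein with (ph (2 / 5) (- (2 / 5)) n m + 1 + ph (- (2 / 5)) (- (2 / 5)) n2 m2) (S + 1 - 2 * d')%Z; auto.
    + etransitivity; [apply (f_equal2 Cmult); [apply (Hshift (2 / 5) (- (2 / 5)) _ _ n m)|apply (Hshift (- (2 / 5)) (- (2 / 5)) _ _ n2 m2)];
        unfold n, m, n2, m2; rewrite ?Ha', ?Hb', ?Hc', ?Hd'; push_IZR; field|].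
      rewrite Hneg2, !Hadd; ring.
    + rewrite HfM. unfold ph, S, n, m, n2, m2. rewrite Ha', Hb', Hc', Hd'. push_IZR. field.
Qed.
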